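(* There exists a universal constant $C>0$ such that the following holds. Let $1<\alpha\le2\le\beta<\infty$ and $K\ge1$, let $\Psi\colon\mathbb{R}^n\to\mathbb{R}$ satisfy condition (C) and the growth condition $(G_{K,\alpha,\beta})$ (both defined in the context), let $D>0$, and let $\mu$ be a probability measure on $\mathbb{R}^n$, absolutely continuous with respect to Lebesgue measure, satisfying the modified logarithmic Sobolev inequality $mLSI(\Psi,D)$. Then for all $\mu$-integrable locally Lipschitz functions $f\colon\mathbb{R}^n\to\mathbb{R}$ and all $p\ge\beta$, $$\|f-\mathbb{E}_\mu f\|_p\le C\,L(K,D,\alpha,\beta)\,\Big\||\nabla f|_{\Psi_p}\Big\|_p ,$$ where $$L(K,D,\alpha,\beta)=\frac1{\alpha-1}(KD)^{1/\beta}+\Big(\frac1{\alpha-1}+\beta^{1/\alpha}\Big)(KD)^{1/\alpha}.$$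
   Context: Condition (C) for $\Psi\colon\mathbb{R}^n\to[0,\infty]$: (C1) $\Psi(0)=0$ and $\Psi$ is continuous at $0$; (C2) $\Psi(x)>0$ for $x\ne0$; (C3) $\lim_{|x|\to\infty}\Psi(x)=\infty$; (C4) for every $x\in\mathbb{R}^n$ the function $t\mapsto\Psi(tx)$ is left-continuous on $(0,\infty)$; (C5) for every $x\in\mathbb{R}^n$ the function $t\mapsto\Psi(tx)/t$ is non-decreasing on $(0,\infty)$; (C6) $\Psi(x)=\Psi(-x)$ for all $x$. Growth condition $(G_{K,\alpha,\beta})$: for all $x\in\mathbb{R}^n\setminus\{0\}$ and all $t\ge1$, $K^{-1}t^\alpha\le\Psi(tx)/\Psi(x)\le Kt^\beta$. $mLSI(\Psi,D)$: for every bounded locally Lipschitz $f\colon\mathbb{R}^n\to(0,\infty)$, $$\mathrm{Ent}_\mu f^2\le D\,\mathbb{E}_\mu\Psi\Big(\frac{\nabla f}{f}\Big)f^2,$$ where $\mathbb{E}_\mu$ is integration with respect to $\mu$ and $\mathrm{Ent}_\mu g=\mathbb{E}_\mu g\log g-\mathbb{E}_\mu g\log\mathbb{E}_\mu g$ for $g\ge 0$. Gradients of locally Lipschitz functions exist Lebesgue-a.e., hence $\mu$-a.e. Norms: for $p>0$, $\Psi_p(x)=\frac1p\Psi(px)$ and $|x|_{\Psi_p}=\inf\{a>0:\Psi_p(x/a)\le1\}$ for $x\in\mathbb{R}^n$ (a quasi-norm). Moments: $\|g\|_p=(\mathbb{E}_\mu|g|^p)^{1/p}$ (possibly $+\infty$).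 A universal constant depends on no parameters (in particular not on $n$). *)

(* Defs.v *)
From HB Require Import structures.
From mathcomp Require Import all_boot all_order all_algebra.
From mathcomp Require Import all_classical all_reals all_analysis.
From mathcomp Require Import measurable_realfun.

Set Implicit Arguments.
Unset Strict Implicit.
Unset Printing Implicit Defensive.

Import Order.TTheory GRing.Theory Num.Theory.
Import numFieldNormedType.Exports.

Local Open Scope classical_set_scope.
Local Open Scope ring_scope.

Definition open_Rn (R : realType) n : set (set 'rV[R]_n) := [set U | open U].

Notation borelRn R n := (g_sigma_algebraType (@open_Rn R n)).

Lemma product_measure1_sigma_finite d1 d2 (T1 : measurableType d1)
    (T2 : measurableType d2) (R : realType)
    (m1 : {sigma_finite_measure set T1 -> \bar R})
    (m2 : {sigma_finite_measure set T2 -> \bar R}) :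
  sigma_finite setT (m1 \x m2)%E.
Proof.
have /sigma_finiteP[F [TF ndF Foo]] := sigma_finiteT m1.
have /sigma_finiteP[G [TG ndG Goo]] := sigma_finiteT m2.
exists (fun n => F n `*` G n).
  rewrite -setXTT TF TG predeqE => -[x y]; split.
    move=> [/= [n _ Fnx] [k _ Gky]]; exists (maxn n k) => //; split.
    - by move: x Fnx; exact/subsetPset/ndF/leq_maxl.
    - by move: y Gky; exact/subsetPset/ndG/leq_maxr.
  by move=> [n _ []/= ? ?]; split; exists n.
move=> k; have [? ?] := Foo k; have [? ?] := Goo k.
split; first exact: measurableX.
by rewrite product_measure1E// lte_mul_pinfty// ge0_fin_numE.
Qed.

Section LebesgueRn.
Context {R : realType}.

Definition cons_row n (xy : measurableTypeR R * borelRn R n) :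
  borelRn R n.+1 := row_mx (xy.1%:M : 'rV[R]_1) (xy.2 : 'rV[R]_n).

Lemma cons_row0 n xy : (@cons_row n xy : 'rV[R]_n.+1) 0 ord0 = xy.1.
Proof.
have -> : (ord0 : 'I_n.+1) = lshift n (ord0 : 'I_1) by apply/val_inj.
by rewrite [LHS]row_mxEl !mxE eqxx.
Qed.

Lemma cons_rowS n xy (j : 'I_n) :
  (@cons_row n xy : 'rV[R]_n.+1) 0 (lift ord0 j) = (xy.2 : 'rV[R]_n) 0 j.
Proof.
have -> : lift ord0 j = rshift 1 j by apply/val_inj.
by rewrite [LHS]row_mxEr.
Qed.

Lemma cons_row_preimage_ball n (c : 'rV[R]_n.+1) e :
  @cons_row n @^-1` (ball c e) =
  ball (c 0 ord0) e `*` ball (\row_j c 0 (lift ord0 j)) e.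
Proof.
apply/seteqP; split => [xy [e0 cxy]|xy [cx [e0 cy]]]; split => //.
- by have := cxy 0 ord0; rewrite cons_row0.
- by split => // i j; rewrite mxE ord1 -cons_rowS; exact: cxy.
- move=> i j; rewrite ord1; case: (unliftP ord0 j) => [k ->|->].
    by rewrite cons_rowS; have := cy 0 k; rewrite mxE.
  by rewrite cons_row0.
Qed.

Lemma open_row_bigcup_ball n (U : set 'rV[R]_n) : open U ->
  exists c (e : nat -> R), U = \bigcup_k ball (c k : 'rV[R]_n) (e k).
Proof.
move=> oU.
pose c k : 'rV[R]_n :=
  if unpickle k is Some q then map_mx ratr (q : 'rV[rat]_n * nat).1 else 0.
pose r k : R :=
  if unpickle k is Some q then (q : 'rV[rat]_n * nat).2.+1%:R^-1 else 0.
pose e k := if `[< ball (c k) (r k) `<=` U >] then r k else 0.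
exists c, e; apply/seteqP; split => [x Ux|x [k _]]; last first.
  by rewrite /e; case: asboolP => [/[apply]//|_ []]; rewrite ltxx.
have /nbhs_ballP[_/posnumP[d] xdU] := open_nbhs_nbhs (conj oU Ux).
have [m _ /(_ m (leqnn _)) /= md] :=
  near_infty_natSinv_lt (d%:num / 2)%:pos.
have m0 : 0 < m.+1%:R^-1 :> R by rewrite invr_gt0.
have qP j : {q : rat | ball (x 0 j) m.+1%:R^-1 (ratr q : R)}.
  apply: cid; have /rat_in_itvoo[q] : x 0 j < x 0 j + m.+1%:R^-1 by rewrite ltrDl.
  rewrite in_itv/= => /andP[xq qx]; exists q.
  by rewrite -ball_normE/= ltr0_norm ?subr_lt0// opprB ltrBlDl.
pose q : 'rV[rat]_n := \row_j sval (qP j).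
have xq : ball (map_mx ratr q : 'rV[R]_n) m.+1%:R^-1 x.
  split => // i j; rewrite ord1 !mxE; apply: ball_sym; exact: (svalP (qP j)).
exists (pickle (q, m)) => //; rewrite /e /c /r pickleK /=.
case: asboolP => // -[] y qy; apply: xdU.
have -> : d%:num = d%:num / 2 + d%:num / 2 by rewrite -splitr.
apply: ball_triangle (le_ball (ltW md) qy).
exact/ball_sym/(le_ball (ltW md)).
Qed.

Lemma continuous_measurable_borelRn n (f : 'rV[R]_n -> R) :
  continuous f -> measurable_fun setT (f : borelRn R n -> measurableTypeR R).
Proof.
move=> /continuousP cf; apply: (measurability _ (RGenOpens.measurableE R)).
move=> _ [_ [a [b ->] <-]]; rewrite setTI; apply: sub_sigma_algebra.
exact/cf/interval_open.
Qed.

Lemma measurable_cons_row n : measurable_fun setT (@cons_row n).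
Proof.
refine (@measurability _ _ _ (borelRn R n.+1) _ _ (@open_Rn R n.+1) (erefl _) _) => _ [U oU <-]; rewrite setTI.
have [c [e ->]] := open_row_bigcup_ball oU.
rewrite preimage_bigcup; apply: bigcupT_measurable => k.
rewrite cons_row_preimage_ball; apply: measurableX.
  exact: measurable_ball.
by apply: sub_sigma_algebra; exact: ball_open.
Qed.

HB.instance Definition _ n :=
  isMeasurableFun.Build _ _ _ _ (@cons_row n) (@measurable_cons_row n).

Definition uncons_row n (x : borelRn R n.+1) :
    measurableTypeR R * borelRn R n :=
  ((x : 'rV[R]_n.+1) 0 ord0, \row_j (x : 'rV[R]_n.+1) 0 (lift ord0 j)).

Lemma cons_rowK n : cancel (@cons_row n) (@uncons_row n).
Proof.
move=> [x y]; congr pair; first by rewrite cons_row0.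
by apply/rowP => j; rewrite mxE cons_rowS.
Qed.

Lemma measurable_uncons_row n : measurable_fun setT (@uncons_row n).
Proof.
apply: measurable_fun_pair.
  by apply: continuous_measurable_borelRn; exact: coord_continuous.
refine (@measurability _ _ _ (borelRn R n) _ _ (@open_Rn R n) (erefl _) _) => _ [U oU <-]; rewrite setTI.
apply: sub_sigma_algebra; move: U oU; apply/continuousP => x.
move=> A /nbhs_ballP[e /= e0 xeA]; apply/nbhs_ballP; exists e => //= y [_ xy].
by apply: xeA; split => // i j; rewrite !mxE; exact: xy.
Qed.

Section lebesgue_cons.
Context n (m : {sigma_finite_measure set (borelRn R n) -> \bar R}).

Definition lebesgue_cons : set (borelRn R n.+1) -> \bar R :=
  pushforward (@lebesgue_measure R \x m)%E (@cons_row n).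

Let lebesgue_cons0 : lebesgue_cons set0 = 0%E.
Proof. exact: measure0. Qed.

Let lebesgue_cons_ge0 A : (0 <= lebesgue_cons A)%E.
Proof. exact: measure_ge0. Qed.

Let lebesgue_cons_sigma_additive : semi_sigma_additive lebesgue_cons.
Proof. exact: measure_semi_sigma_additive. Qed.

HB.instance Definition _ := isMeasure.Build _ _ _ lebesgue_cons
  lebesgue_cons0 lebesgue_cons_ge0 lebesgue_cons_sigma_additive.

Let lebesgue_cons_sigma_finite : sigma_finite setT lebesgue_cons.
Proof.
have [F FT Foo] : sigma_finite setT (@lebesgue_measure R \x m)%E.
  exact: product_measure1_sigma_finite.
exists (fun k => @uncons_row n @^-1` F k).
  by rewrite -preimage_bigcup -FT preimage_setT.
move=> k; have [mF Fk] := Foo k; split.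
  by rewrite -[X in measurable X]setTI; exact: measurable_uncons_row.
rewrite /lebesgue_cons /pushforward -comp_preimage.
by rewrite (_ : _ \o _ = id) ?preimage_id//; apply/funext => x; exact: cons_rowK.
Qed.

HB.instance Definition _ := Measure_isSigmaFinite.Build _ _ _ lebesgue_cons
  lebesgue_cons_sigma_finite.

End lebesgue_cons.

Fixpoint lebesgue_Rn n : {sigma_finite_measure set (borelRn R n) -> \bar R} :=
  match n with
  | 0 => dirac ((0 : 'rV[R]_0) : borelRn R 0)
  | n'.+1 => lebesgue_cons (lebesgue_Rn n')
  end.

Lemma lebesgue_Rn_box n (A : 'I_n -> set R) :
  (forall i, measurable (A i : set (measurableTypeR R))) ->
  lebesgue_Rn n [set x | forall i, A i ((x : 'rV[R]_n) 0 i)] =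
  (\prod_(i < n) @lebesgue_measure R (A i))%E.
Proof.
elim: n A => [A mA|n IH A mA].
  by rewrite big_ord0 /= diracE mem_set// => -[].
rewrite big_ord_recl -IH//= /lebesgue_cons /pushforward.
rewrite (_ : _ @^-1` _ = A ord0 `*`
    [set x | forall i, A (lift ord0 i) ((x : 'rV[R]_n) 0 i)]); last first.
  apply/seteqP; split => [xy Axy|xy [Ax Ay] i].
    split; first by have := Axy ord0; rewrite cons_row0.
    by move=> i; have := Axy (lift ord0 i); rewrite cons_rowS.
  case: (unliftP ord0 i) => [k ->|->]; last by rewrite cons_row0.
  by rewrite cons_rowS; exact: Ay.
rewrite product_measure1E//.
rewrite (_ : [set _ | _] = \bigcap_i
  [set x : borelRn R n | A (lift ord0 i) ((x : 'rV[R]_n) 0 i)]).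
  apply: fin_bigcap_measurable => // i _.
  rewrite -[X in measurable X]setTI.
  apply: (continuous_measurable_borelRn (f := fun x => x 0 i)) => //.
  exact: coord_continuous.
by apply/seteqP; split => [x xA i _|x xA i]; exact: xA.
Qed.

End LebesgueRn.

Section ModifiedLogSobolev.
Context {R : realType}.

(* Junk values at points where a partial derivative does not exist; for a
   locally Lipschitz function these points form a Lebesgue-null set. *)
Definition grad n (f : 'rV[R]_n -> R) (x : 'rV[R]_n) : 'rV[R]_n :=
  \row_i 'D_(delta_mx 0 i) f x.

(* This is not [locally [lipschitz f x | x in setT]], which also quantifies
   over neighbourhoods of off-diagonal pairs. *)
Definition loc_lipschitz n (f : 'rV[R]_n -> R) : Prop :=
  forall x : 'rV[R]_n, exists2 U : set 'rV[R]_n, nbhs x U & [lipschitz f y | y in U].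

(* The norm in C3 is the sup norm of the library; all norms on R^n are
   equivalent. *)
Record condC n (Psi : 'rV[R]_n -> R) : Prop := CondC {
  condC1_0 : Psi 0 = 0 ;
  condC1_continuous : {for 0, continuous Psi} ;
  condC2 : forall x, x != 0 -> 0 < Psi x ;
  condC3 : forall M : R, \forall r \near +oo,
    forall x : 'rV[R]_n, r < `|x| -> M < Psi x ;
  condC4 : forall (x : 'rV[R]_n) (t : R), 0 < t ->
    Psi (s *: x) @[s --> t^'-] --> Psi (t *: x) ;
  condC5 : forall (x : 'rV[R]_n) (s t : R), 0 < s -> s <= t ->
    Psi (s *: x) / s <= Psi (t *: x) / t ;
  condC6 : forall x, Psi x = Psi (- x) }.

Definition condG n (Psi : 'rV[R]_n -> R) (K alpha beta : R) : Prop :=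
  forall (x : 'rV[R]_n) (t : R), x != 0 -> 1 <= t ->
    K^-1 * t `^ alpha <= Psi (t *: x) / Psi x <= K * t `^ beta.

(* 0 * ln 0 = 0 and 0 * lne 0 = 0 in the library. *)
Definition Ent n (mu : probability (borelRn R n) R) (g : 'rV[R]_n -> R) :
    \bar R :=
  (\int[mu]_x (g x * ln (g x))%R%:E - 'E_mu[g] * lne 'E_mu[g])%E.

Definition mLSI n (mu : probability (borelRn R n) R) (Psi : 'rV[R]_n -> R)
    (D : R) : Prop :=
  forall f : 'rV[R]_n -> R, (forall x, 0 < f x) -> bounded_fun f ->
    loc_lipschitz f ->
    (Ent mu (fun x => (f x ^+ 2)%R) <=
     D%:E * \int[mu]_x (Psi ((f x)^-1 *: grad f x) * f x ^+ 2)%R%:E)%E.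

Definition Psi_scaled n (Psi : 'rV[R]_n -> R) (p : R) (x : 'rV[R]_n) : R :=
  p^-1 * Psi (p *: x).

Definition Psi_norm n (Psi : 'rV[R]_n -> R) (p : R) (x : 'rV[R]_n) : R :=
  inf [set a : R | 0 < a /\ Psi_scaled Psi p (a^-1 *: x) <= 1].

Definition moment_const (K D alpha beta : R) : R :=
  (alpha - 1)^-1 * (K * D) `^ beta^-1 +
  ((alpha - 1)^-1 + beta `^ alpha^-1) * (K * D) `^ alpha^-1.

End ModifiedLogSobolev.

(* Main.v *)
Require Import Defs.
From HB Require Import structures.
From mathcomp Require Import all_boot all_order all_algebra.
From mathcomp Require Import all_classical all_reals all_analysis.
From mathcomp Require Import measurable_realfun ring lra.

Set Implicit Arguments.
Unset Strict Implicit.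
Unset Printing Implicit Defensive.

Import Order.TTheory GRing.Theory Num.Theory.
Import numFieldNormedType.Exports.
Import HBSimple HBNNSimple.

Local Open Scope classical_set_scope.
Local Open Scope ring_scope.

(** Fix a median [m] of [f] and let [g] be a smooth bounded positive truncation
    of [(f - m)_+]. Testing the modified log-Sobolev inequality on [g^(q/2)] and
    bounding [Ent h^2] from below by [E h^2 * ln (E h^2 / (E h)^2)] yields, with
    [A] the [L^p] norm of the gradient and [X = (q/p) A / |g|_q],
      [ln (E g^q / (E g^(q/2))^2) <= 3 D K p (X^alpha + X^beta)].
    Hence [|g|_q <= |g|_(q/2) + 2 T (q/p)^(alpha-1)] as soon as [|g|_q] exceeds
    [T = 3 A ((K D)^(1/alpha) + (K D)^(1/beta))]; halving [q] from [p] down to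
    [[beta, 2 beta]], the error terms form a geometric series, whence the factor
    [1/(alpha-1)]. In the last range, [g] is minimal on a set of measure at least
    1/2, so that [(E g^(q/2))^2 <= 2/3 E g^q] and the same inequality bounds
    [|g|_q] outright. Removing the truncation, adding the same bound for [-f], and
    passing from the median to the mean concludes. *)

(** * Locally Lipschitz functions and a chain rule for directional derivatives *)

Section ChainRule.
Context {R : realType}.

Lemma loc_lipschitzP n (f : 'rV[R]_n -> R) : loc_lipschitz f <->
  forall x : 'rV[R]_n, exists2 M : R, 0 < M & exists2 U : set 'rV[R]_n,
    nbhs x U & forall y z, U y -> U z -> `|f y - f z| <= M * `|y - z|.
Proof.
split=> lf x; have := lf x.
  move=> [U Ux]; move/pinfty_ex_gt0 => [M M0 fM]; exists M => //; exists U => //.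
  by move=> y z Uy Uz; exact: (fM (y, z)).
move=> [M M0 [U Ux fM]]; exists U => //.
apply: filterS (nbhs_pinfty_ge (num_real M)) => k Mk -[y z] [Uy Uz] /=.
by apply: le_trans (fM _ _ Uy Uz) _; exact: ler_wpM2r.
Qed.

Lemma loc_lipschitz_continuous n (f : 'rV[R]_n -> R) :
  loc_lipschitz f -> continuous f.
Proof.
move=> /loc_lipschitzP lf x.
have [M M0 [U Ux fM]] := lf x.
apply/(@cvgrPdist_lt _ _ _ _ (nbhs_filter x)) => e e0.
have xb : nbhs x (ball x (e / M)) by apply: nbhsx_ballx; rewrite divr_gt0.
apply: (@filterS _ (nbhs x) _ _ _ _ (filterI Ux xb)) => y [Uy].
rewrite -ball_normE /= ltr_pdivlMr// mulrC => /(le_lt_trans _); apply.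
exact: fM (nbhs_singleton Ux) Uy.
Qed.

Lemma loc_lipschitzN n (f : 'rV[R]_n -> R) :
  loc_lipschitz f -> loc_lipschitz (fun x => - f x).
Proof.
move=> /loc_lipschitzP lf; apply/loc_lipschitzP => x.
have [M M0 [U Ux fM]] := lf x; exists M => //; exists U => // y z Uy Uz.
by rewrite -opprD normrN; exact: fM.
Qed.

Lemma loc_lipschitz_comp n (f : 'rV[R]_n -> R) (phi : R -> R) (k : R) :
  0 < k -> (forall a b, `|phi a - phi b| <= k * `|a - b|) ->
  loc_lipschitz f -> loc_lipschitz (phi \o f).
Proof.
move=> k0 kphi /loc_lipschitzP lf; apply/loc_lipschitzP => x.
have [M M0 [U Ux fM]] := lf x; exists (k * M); first exact: mulr_gt0.
exists U => // y z Uy Uz; apply: le_trans (kphi _ _) _.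
by rewrite -mulrA ler_pM2l//; exact: fM.
Qed.

Lemma lipschitz_derive_le (phi dphi : R -> R) (k : R) :
  (forall y : R, is_derive y 1 phi (dphi y)) -> (forall y, `|dphi y| <= k) ->
  forall a b, `|phi a - phi b| <= k * `|a - b|.
Proof.
move=> dP dk.
have H a b : a < b -> `|phi b - phi a| <= k * `|b - a|.
  move=> ab; have cphi : {within `[a, b], continuous phi}.
    by apply: derivable_within_continuous => x _; have [] := dP x.
  have [c _ ->] := MVT ab (fun x _ => dP x) cphi.
  by rewrite normrM; apply: ler_wpM2r.
move=> a b; have [ab|ab|->] := ltgtP a b.
- by rewrite distrC (distrC a); exact: H.
- exact: H.
- by rewrite !subrr normr0 mulr0.
Qed.

(* No differentiability of [f] is assumed: where the derivative of [f] does not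
   exist, either [l = 0] and the Lipschitz bound gives derivative [0], or
   [l != 0] and both sides are the junk value [0]. *)
Lemma derive_comp_loc_lipschitz n (f : 'rV[R]_n -> R) (phi : R -> R)
    (x v : 'rV[R]_n) (l : R) :
  loc_lipschitz f -> is_derive (f x) 1 phi l ->
  'D_v (phi \o f) x = l * 'D_v f x.
Proof.
move=> lf [dphi phil].
have fc := @loc_lipschitz_continuous n f lf x.
have shift_cvg : (h *: v + x) @[h --> (0 : R)^'] --> x.
  rewrite -[X in _ --> X]add0r -(scale0r v).
  apply: (@cvgD _ _ _ _ _ (fun h : R => h *: v) (fun=> x)); last exact: cvg_cst.
  apply: cvgZr_tmp.
  exact: cvg_within.
pose F (h : R) := h^-1 *: (f (h *: v + x) - f x).
(* [psi] is the slope of [phi] at [f x], extended by its limit [l]; the difference quotient of the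
   composite is then exactly [S h * F h], also for those [h] that leave the value of [f]
   unchanged. *)
pose psi (y : R) := if y == f x then l else (phi y - phi (f x)) / (y - f x).
have psic : psi y @[y --> f x] --> l.
  apply/cvgrPdist_lt => e e0.
  have : (h^-1 *: (phi (h + f x) - phi (f x))) @[h --> (0 : R)^'] --> l.
    have := dphi; rewrite /derivable => /cvg_ex[l' Hl'].
    have <- : l' = l.
      rewrite -phil /derive; apply/esym/cvg_lim => //.
    by under eq_fun do rewrite -[X in X + f x]mulr1.
  move/cvgrPdist_lt => /(_ e e0).
  rewrite near_withinE => H.
  have : \forall y \near f x, y - f x != 0 ->
     `|l - (y - f x)^-1 *: (phi (y - f x + f x) - phi (f x))| < e.
    have cs : (y - f x) @[y --> f x] --> (0 : R).
      rewrite -(subrr (f x)); apply: cvgB; [exact: cvg_id|exact: cvg_cst].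
    exact: (cs _ H).
  apply: filterS => y Hy; rewrite /psi; case: eqP => [_|/eqP yf].
    by rewrite subrr normr0.
  by move: Hy; rewrite subr_eq0 => /(_ yf); rewrite subrK [_ *: _]mulrC.
pose S (h : R) := psi (f (h *: v + x)).
have Sc : S h @[h --> (0 : R)^'] --> l.
  by apply: (@cvg_comp _ _ _ _ psi _ _ _ _ psic); exact: cvg_comp shift_cvg fc.
have quotE : (fun h : R => h^-1 *: ((phi \o f) (h *: v + x) - (phi \o f) x)) =
    (fun h => S h * F h).
  apply/funext => h; rewrite /S /F /psi /=; case: eqP => [->|/eqP yf].
    by rewrite !subrr !scaler0 mulr0.
  have scaleE (a c : R) : c != 0 -> h^-1 *: a = a / c * (h^-1 *: c).
    by move=> c0; rewrite -scalerAr [a / c * c]divfK.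
  by apply: scaleE; rewrite subr_eq0.
rewrite /derive quotE.
have [l_eq0|l0] := eqVneq l 0.
  rewrite l_eq0 mul0r; apply/cvg_lim => //.
  have [M M0 [U Ux fM]] := (loc_lipschitzP f).1 lf x.
  have FB : \forall h \near (0 : R)^', `|F h| <= M * `|v|.
    near=> h.
    have h0 : h != 0 by near: h; exact: nbhs_dnbhs_neq.
    rewrite /F normrM normfV ler_pdivrMl ?normr_gt0//.
    apply: le_trans (fM _ _ _ (nbhs_singleton Ux)) _.
      by near: h; exact: shift_cvg.
    by rewrite addrK normrZ mulrCA.
  apply/cvgr0Pnorm_lt => e e0.
  have k0 : 0 < M * `|v| + 1 by rewrite ltr_wpDl// mulr_ge0// ltW.
  have : \forall h \near (0 : R)^', `|S h| < e / (M * `|v| + 1).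
    have := Sc; rewrite l_eq0 => /cvgr0Pnorm_lt; apply; exact: divr_gt0.
  move=> SB; near=> h.
  rewrite normrM; apply: (@le_lt_trans _ _ (`|S h| * (M * `|v| + 1))).
    apply: ler_wpM2l => //; apply: (@le_trans _ _ (M * `|v|)); last by rewrite lerDl.
    by near: h.
  by rewrite -ltr_pdivlMr//; near: h.
have [/cvg_ex[d Fd]|nF] := pselect (cvg (F h @[h --> (0 : R)^'])).
  have -> : lim (F h @[h --> 0^']) = d by apply/cvg_lim.
  by apply/cvg_lim => //; exact: cvgM.
(* Were [S h * F h] convergent, division by [S h], whose limit [l] is nonzero, would make [F h]
   converge. *)
rewrite (dvgP nF) dvgP ?mulr0// => /cvg_ex[d SFd]; apply: nF; apply/cvg_ex.
exists (l^-1 * d).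
have H : (S h)^-1 * (S h * F h) @[h --> (0 : R)^'] --> l^-1 * d.
  by apply: cvgM => //; exact: cvgV.
apply: cvg_trans H; apply: near_eq_cvg.
have S0 : \forall h \near (0 : R)^', S h != 0 by exact: (cvgr_neq0 l Sc l0).
by near=> h; rewrite mulKf//; near: h.
Unshelve. all: by end_near. Qed.

End ChainRule.

(** * Smooth bounded truncation of the squared positive part *)

Section Truncation.
Context {R : realType}.

(** The square removes the kink of the positive part at 0, so that the chain rule applies at every
    point. *)
Definition pos_sqr (y : R) : R := Num.max y 0 ^+ 2.

Lemma pos_sqr_ge0 y : 0 <= pos_sqr y. Proof. exact: sqr_ge0. Qed.

Lemma is_derive_pos_sqr (y : R) :
  is_derive y 1 pos_sqr (2 * Num.max y 0).
Proof.
suff H : h^-1 *: (pos_sqr (h *: 1 + y) - pos_sqr y) @[h --> (0 : R)^']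
    --> 2 * Num.max y 0.
  split; last by apply/cvg_lim => //; exact: H.
  by apply/cvg_ex; exists (2 * Num.max y 0); exact: H.
apply/cvgrPdist_lt => e e0.
near=> h.
have h0 : h != 0 by near: h; exact: nbhs_dnbhs_neq.
have he : `|h| < e.
  by near: h; apply: dnbhs0_lt.
apply: le_lt_trans he.
have -> : h *: (1 : R) = h by rewrite /GRing.scale /= mulr1.
(* It is enough that the remainder of the first-order expansion is at most [h ^+ 2], which is
   checked on the four sign cases of [y] and [h + y]. *)
have -> : 2 * Num.max y 0 - h^-1 *: (pos_sqr (h + y) - pos_sqr y) =
   h^-1 * (2 * h * Num.max y 0 - (pos_sqr (h + y) - pos_sqr y)).
  by rewrite /GRing.scale /=; field.
rewrite normrM normfV ler_pdivrMl ?normr_gt0// -normrM -expr2 (ger0_norm (sqr_ge0 h)).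
rewrite /pos_sqr ler_norml.
by case: (lerP y 0) => ?; case: (lerP (h + y) 0) => ?; apply/andP; split; nra.
Unshelve. all: by end_near. Qed.

(* With [w = (y - m)_+ ^ 2] this is [(e + w) / (1 + e w)], a smooth bounded
   function with values in [e, 1/e] that tends to [w] as [e -> 0]; its square
   root plays the role of [(y - m)_+]. *)
Definition trunc_sqr (e m y : R) : R :=
  (e + pos_sqr (y - m)) / (1 + e * pos_sqr (y - m)).

Definition dtrunc_sqr (e m y : R) : R :=
  2 * Num.max (y - m) 0 * (1 - e ^+ 2) / (1 + e * pos_sqr (y - m)) ^+ 2.

Section facts.
Variables (e m : R).
Hypotheses (e0 : 0 < e) (e1 : e < 1).

Let den_ge1 y : 1 <= 1 + e * pos_sqr (y - m).
Proof. by rewrite lerDl mulr_ge0 ?pos_sqr_ge0// ltW. Qed.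

Let den_gt0 y : 0 < 1 + e * pos_sqr (y - m).
Proof. exact: lt_le_trans (den_ge1 y). Qed.

Lemma trunc_sqr_ge y : e <= trunc_sqr e m y.
Proof.
rewrite ler_pdivlMr// mulrDr mulr1 lerD2l mulrA ler_piMl ?pos_sqr_ge0//.
by rewrite -expr2 expr_le1 ?ltW.
Qed.

Lemma trunc_sqr_gt0 y : 0 < trunc_sqr e m y.
Proof. exact: lt_le_trans (trunc_sqr_ge y). Qed.

Lemma trunc_sqr_le y : trunc_sqr e m y <= e^-1.
Proof.
rewrite ler_pdivrMr// mulrDr mulr1 mulKf ?gt_eqF// lerD2r.
by rewrite (le_trans (ltW e1))// invf_ge1// ltW.
Qed.

Lemma trunc_sqr_id y : y <= m -> trunc_sqr e m y = e.
Proof.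
move=> ym; rewrite /trunc_sqr /pos_sqr (max_idPr _) ?subr_le0//.
by rewrite expr0n /= mulr0 !addr0 divr1.
Qed.

(** Let [w] be the squared positive part. While [e * w <= 1] the denominator is at most 2; beyond
    that [w] exceeds [e^-1], and the quotient is at least half of [e^-1]. The cap [e^-1] disappears
    as [e] tends to 0, which later lets the truncation be removed. *)
Lemma trunc_sqr_ge_min y :
  Num.min (pos_sqr (y - m)) e^-1 <= 2 * trunc_sqr e m y.
Proof.
rewrite /trunc_sqr; have := pos_sqr_ge0 (y - m); have := den_gt0 y.
move: (pos_sqr _) => w d0 w0; have := e0 => e_gt0.
rewrite mulrA ler_pdivlMr//; have [ew|ew] := leP (e * w) 1.
  apply: (@le_trans _ _ (w * (1 + e * w))).
    by rewrite ler_wpM2r ?(ltW d0)// ge_min lexx.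
  have := mulr_ge0 w0 (_ : 0 <= 1 - e * w); rewrite subr_ge0 => /(_ ew) ?; lra.
apply: (@le_trans _ _ (e^-1 * (1 + e * w))).
  by rewrite ler_wpM2r ?(ltW d0)// ge_min lexx orbT.
by rewrite ler_pdivrMl//; nra.
Qed.

Lemma is_derive_trunc_sqr (y : R) :
  is_derive y 1 (trunc_sqr e m) (dtrunc_sqr e m y).
Proof.
have dw : is_derive y 1 (fun y => pos_sqr (y - m)) (2 * Num.max (y - m) 0).
  have := @is_derive1_comp R pos_sqr (fun y => y - m) y _ 1 (is_derive_pos_sqr _).
  rewrite mulr1; apply.
  by have := is_deriveB (is_derive_id y 1) (is_derive_cst m y 1); rewrite subr0.
have dn : is_derive y 1 (fun y => e + pos_sqr (y - m)) (2 * Num.max (y - m) 0).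
  by have := is_deriveD (is_derive_cst (e : R) y 1) dw; rewrite add0r.
have dd : is_derive y 1 (fun y => 1 + e * pos_sqr (y - m))
    (e * (2 * Num.max (y - m) 0)).
  by have := is_deriveD (is_derive_cst (1 : R) y 1) (is_deriveZ e dw); rewrite add0r.
have di := @is_deriveV R (fun y => 1 + e * pos_sqr (y - m)) _ _ _ (lt0r_neq0 (den_gt0 y)) dd.
apply: (is_derive_eq (is_deriveM dn di)); rewrite /dtrunc_sqr.
have := den_gt0 y; rewrite /GRing.scale /= => /lt0r_neq0 ?.
by field.
Qed.

Lemma dtrunc_sqr_ge0 y : 0 <= dtrunc_sqr e m y.
Proof.
rewrite /dtrunc_sqr divr_ge0 ?sqr_ge0// !mulr_ge0 ?le_max ?lexx ?orbT//.
by rewrite subr_ge0 expr_le1 ?ltW.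
Qed.

(** This makes the square root of the truncation 1-Lipschitz, as [(y - m)_+] is. With
    [s = (y - m)_+] and the denominator [d >= 1], the derivative is [2 (s / d) (1 - e^2) / d], and
    [(s / d)^2 <= s^2 / d <= trunc_sqr e m y]. *)
Lemma dtrunc_sqr_le y : dtrunc_sqr e m y <= 2 * trunc_sqr e m y `^ 2^-1.
Proof.
rewrite powR12_sqrt; last exact/ltW/trunc_sqr_gt0.
set s := Num.max (y - m) 0; set d := 1 + e * pos_sqr (y - m).
have s0 : 0 <= s by rewrite le_max lexx orbT.
have d1 : 1 <= d := den_ge1 y.
have d0 : 0 < d := den_gt0 y.
have sd : s / d <= Num.sqrt (trunc_sqr e m y).
  rewrite -(ger0_norm (divr_ge0 s0 (ltW d0))) -sqrtr_sqr ler_sqrt; last first.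
    exact/ltW/trunc_sqr_gt0.
  rewrite /trunc_sqr -/d expr_div_n ler_pdivrMr ?exprn_gt0//.
  have -> : (e + pos_sqr (y - m)) / d * d ^+ 2 = (e + pos_sqr (y - m)) * d.
    by field; rewrite gt_eqF.
  rewrite -/(pos_sqr (y - m)) (@le_trans _ _ (pos_sqr (y - m) * d))//.
    by rewrite ler_peMr// pos_sqr_ge0.
  by rewrite ler_wpM2r ?(ltW d0)// lerDr ltW.
have -> : dtrunc_sqr e m y = 2 * (s / d * ((1 - e ^+ 2) / d)).
  by rewrite /dtrunc_sqr -/s -/d; field; rewrite gt_eqF.
apply: ler_wpM2l => //; apply: le_trans sd; apply: ler_piMr; rewrite ?divr_ge0 ?(ltW d0)//.
by rewrite ler_pdivrMr// mul1r (le_trans _ d1)// gerBl sqr_ge0.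
Qed.

End facts.

Section grad_trunc.
Variables (n : nat) (f : 'rV[R]_n -> R) (e m r : R).
Hypotheses (lf : loc_lipschitz f) (e0 : 0 < e) (e1 : e < 1) (r0 : 0 < r).

Let z := trunc_sqr e m.
Let z_gt0 y : 0 < z y. Proof. exact: trunc_sqr_gt0. Qed.

Let dphi y := r * z y `^ (r - 1) * dtrunc_sqr e m y.

Let is_derive_phi (y : R) : is_derive y 1 (fun y : R => z y `^ r) (dphi y).
Proof.
have := is_derive1_comp (is_derive1_powR r (z_gt0 y)) (is_derive_trunc_sqr m e0 y).
exact.
Qed.

Let c y := r * dtrunc_sqr e m y / z y.

Let dphiE y : dphi y = c y * z y `^ r.
Proof.
have z0 := z_gt0 y.
have zr : z y `^ (r - 1) = z y `^ r / z y.
  by rewrite powRB ?(gt_eqF z0) ?implybT// (powRr1 (ltW z0)).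
by rewrite /dphi /c zr; field; rewrite gt_eqF.
Qed.

Let c_ge0 y : 0 <= c y.
Proof. by rewrite divr_ge0 ?(ltW (z_gt0 y))// mulr_ge0 ?(ltW r0)// dtrunc_sqr_ge0. Qed.

Let c_le y : c y <= 2 * r / z y `^ 2^-1.
Proof.
have zy0 := z_gt0 y; have dle := dtrunc_sqr_le m e0 e1 y.
have a0 : 0 < z y `^ 2^-1 by exact: powR_gt0.
have zz : z y = z y `^ 2^-1 * z y `^ 2^-1.
  rewrite -powRD; last by rewrite gt_eqF// implybT.
  by rewrite (_ : 2^-1 + 2^-1 = 1) ?(powRr1 (ltW zy0))//; lra.
rewrite /c ler_pdivrMr// [X in _ <= _ * X]zz.
have -> : 2 * r / z y `^ 2^-1 * (z y `^ 2^-1 * z y `^ 2^-1) = r * (2 * z y `^ 2^-1).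
  by field; rewrite gt_eqF.
by rewrite ler_pM2l.
Qed.

Lemma loc_lipschitz_trunc : loc_lipschitz (fun x => trunc_sqr e m (f x) `^ r).
Proof.
(* The derivative is at most [2 * r] times [z] to the power -1/2 times [z] to the power [r]; the
   first power is largest at [z = e], the second at [z = e^-1]. *)
pose k := 2 * r / e `^ 2^-1 * e^-1 `^ r.
have k0 : 0 < k by rewrite !mulr_gt0 ?invr_gt0 ?powR_gt0 ?invr_gt0.
have := @loc_lipschitz_comp R n f (fun y => z y `^ r) k k0.
apply => //; apply: (lipschitz_derive_le is_derive_phi) => y.
rewrite dphiE (ger0_norm (mulr_ge0 (c_ge0 y) (powR_ge0 _ _))).
apply: ler_pM; rewrite ?powR_ge0//; last first.
  apply: ge0_ler_powR; rewrite ?nnegrE ?invr_ge0 ?(ltW r0) ?(ltW e0) ?(ltW (z_gt0 _))//.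
  exact: trunc_sqr_le.
apply: le_trans (c_le y) _; apply: ler_wpM2l; first by rewrite mulr_ge0// ltW.
rewrite lef_pV2 ?posrE ?powR_gt0//; apply: ge0_ler_powR; rewrite ?nnegrE ?invr_ge0 ?(ltW e0) ?(ltW (z_gt0 _))//.
exact: trunc_sqr_ge.
Qed.

(** The modified log-Sobolev inequality sees a test function only through [grad h / h]. For a power
    of the truncation this is a nonnegative multiple of [grad f], the logarithmic derivative being
    controlled by [dtrunc_sqr_le]. *)
Lemma grad_trunc x : exists2 c : R,
  0 <= c <= 2 * r / trunc_sqr e m (f x) `^ 2^-1 &
  (trunc_sqr e m (f x) `^ r)^-1 *: grad (fun x => trunc_sqr e m (f x) `^ r) x =
  c *: grad f x.
Proof.
exists (c (f x)); first by rewrite c_ge0 c_le.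
apply/rowP => i; rewrite !mxE.
rewrite (derive_comp_loc_lipschitz _ lf (is_derive_phi (f x))) dphiE.
by rewrite mulrA [_^-1 * _]mulrC mulfK// gt_eqF// powR_gt0.
Qed.

End grad_trunc.

End Truncation.

(** * Growth of [Psi] along rays and the gauge [Psi_norm] *)

Section OrliczGauge.
Context {R : realType} (n : nat) (Psi : 'rV[R]_n -> R) (K alpha beta p : R).
Hypotheses (CPsi : condC Psi) (GPsi : condG Psi K alpha beta).
Hypotheses (K1 : 1 <= K) (p0 : 0 < p).

Let Psi_ge0 x : 0 <= Psi x.
Proof.
have [->|x0] := eqVneq x 0; first by rewrite (condC1_0 CPsi).
exact/ltW/(condC2 CPsi).
Qed.

Lemma condC_homo (x : 'rV[R]_n) (s t : R) : 0 <= s -> s <= t ->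
  Psi (s *: x) <= Psi (t *: x).
Proof.
rewrite le_eqVlt => /predU1P[<- _|s0 st].
  by rewrite scale0r (condC1_0 CPsi).
have t0 : 0 < t by exact: lt_le_trans st.
have := condC5 CPsi x s0 st; rewrite ler_pdivrMr// => /le_trans; apply.
by rewrite -mulrA ler_piMr// mulrC ler_pdivrMr// mul1r.
Qed.

(** For [t < 1] the lower growth bound is applied at the point [t *: x] with the factor [t^-1]; the
    sum of the two powers covers both ranges of [t]. *)
Lemma condG_le (x : 'rV[R]_n) (t : R) : 0 <= t ->
  Psi (t *: x) <= K * (t `^ alpha + t `^ beta) * Psi x.
Proof.
move=> t0; have K0 : 0 < K by exact: lt_le_trans K1.
have [->|x0] := eqVneq x 0; first by rewrite scaler0 (condC1_0 CPsi) mulr0.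
have [->|t_neq0] := eqVneq t 0.
  by rewrite scale0r (condC1_0 CPsi) !mulr_ge0 ?addr_ge0 ?powR_ge0// ltW.
have Px := condC2 CPsi x0.
have {t_neq0}t0 : 0 < t by rewrite lt_neqAle eq_sym t_neq0.
have [t1|t1] := leP 1 t.
  have /andP[_] := GPsi x0 t1; rewrite ler_pdivrMr// => /le_trans; apply.
  by rewrite ler_wpM2r// ler_wpM2l ?(ltW K0)// lerDr powR_ge0.
have tx0 : t *: x != 0 by rewrite scaler_eq0 negb_or gt_eqF.
have ti1 : 1 <= t^-1 by rewrite invf_ge1// ltW.
have /andP[+ _] := GPsi tx0 ti1.
rewrite scalerA mulVf ?gt_eqF// scale1r ler_pdivlMr ?(condC2 CPsi)// => H.
have {}H : Psi (t *: x) <= K * t `^ alpha * Psi x.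
  move: H; rewrite -(powR_inv1 (ltW t0)) -powRrM mulN1r powRN -invfM.
  by rewrite ler_pdivrMl// mulr_gt0 ?powR_gt0.
apply: le_trans H _; rewrite ler_wpM2r// ler_wpM2l ?(ltW K0)// lerDl powR_ge0//.
Qed.

Let gauge (v : 'rV[R]_n) := [set a : R | 0 < a /\ Psi_scaled Psi p (a^-1 *: v) <= 1].

Let gaugeE v a : gauge v a <-> 0 < a /\ Psi ((p / a) *: v) <= p.
Proof.
by rewrite /gauge /Psi_scaled /= scalerA ler_pdivrMl// mulr1.
Qed.

Lemma Psi_gauge_nonempty v : gauge v !=set0.
Proof.
have [->|v0] := eqVneq v 0.
  by exists 1; apply/gaugeE; split => //; rewrite scaler0 (condC1_0 CPsi) ltW.
have /cvgrPdist_lt /(_ _ p0) := condC1_continuous CPsi.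
rewrite (condC1_0 CPsi) => /nbhs_ballP[d /= d0 dP].
have nv0 : 0 < `|v| by rewrite normr_gt0.
(* With this choice [(p / a) *: v] has norm [d / 2], inside the ball where [Psi < p]. *)
pose a := 2 * p * `|v| / d.
have a0 : 0 < a by apply: divr_gt0 => //; rewrite !mulr_gt0.
exists a; apply/gaugeE; split => //.
have H : ball 0 d ((p / a) *: v).
  rewrite -ball_normE /= sub0r normrN normrZ (gtr0_norm (divr_gt0 p0 a0)).
  rewrite /a invf_div; have -> : p * (d / (2 * p * `|v|)) * `|v| = d / 2.
    by field; rewrite !gt_eqF.
  by rewrite ltr_pdivrMr// ltr_pMr// ltr1n.
by have := dP _ H; rewrite /= sub0r normrN => /ltW; rewrite ger0_norm.
Qed.

Lemma Psi_norm_ge0 v : 0 <= Psi_norm Psi p v.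
Proof.
apply: lb_le_inf; first exact: Psi_gauge_nonempty.
by move=> a /gaugeE[/ltW].
Qed.

(** By coercivity [Psi] exceeds [p] outside some radius [r], so no element of the gauge set lies
    below [p * |v| / r]. *)
Lemma Psi_norm_gt0 v : v != 0 -> 0 < Psi_norm Psi p v.
Proof.
move=> v0; have := condC3 CPsi p => /pinfty_ex_gt0[r r0 rP].
have nv0 : 0 < `|v| by rewrite normr_gt0.
apply: (@lt_le_trans _ _ (p * `|v| / r)); first by apply: divr_gt0 => //; rewrite !mulr_gt0.
apply: lb_le_inf; first exact: Psi_gauge_nonempty.
move=> a /gaugeE[a0 aP]; rewrite leNgt; apply/negP => ar.
suff : p < Psi ((p / a) *: v) by rewrite ltNge aP.
apply: rP; rewrite normrZ gtr0_norm ?divr_gt0//.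
by move: ar; rewrite ltr_pdivlMr// mulrAC ltr_pdivlMr// mulrC.
Qed.

(** The factor 2 leaves room for an element of the gauge set below [2 * a], where [a] is the gauge
    of [v]. Hence [Psi <= p] at [(p / (2 * a)) *: v], and [c *: v] is the multiple of that vector by
    [2 * c * a / p <= r]. *)
Lemma Psi_norm_growth v (c r : R) : 0 <= c ->
  2 * c * Psi_norm Psi p v <= r * p ->
  Psi (c *: v) <= K * p * (r `^ alpha + r `^ beta).
Proof.
move=> c0 cr.
have r0 : 0 <= r.
  rewrite -(pmulr_lge0 _ p0) (le_trans _ cr)// !mulr_ge0// Psi_norm_ge0//.
have K0 : 0 <= K by exact: le_trans K1.
have [->|v0] := eqVneq v 0.
  by rewrite scaler0 (condC1_0 CPsi) !mulr_ge0 ?addr_ge0 ?powR_ge0// ltW.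
have a0 := Psi_norm_gt0 v0; set a := Psi_norm Psi p v in cr a0 *.
have [b /gaugeE[b0 bP] ba] : exists2 b, gauge v b & b < 2 * a.
  have hinf : has_inf (gauge v).
    split; first exact: Psi_gauge_nonempty.
    by exists 0 => b /gaugeE[/ltW].
  have [b gb ba] := inf_adherent a0 hinf.
  by exists b => //; rewrite mulr_natl mulr2n.
have P1 : Psi ((p / (2 * a)) *: v) <= p.
  apply: le_trans bP; apply: condC_homo; first by rewrite divr_ge0 ?mulr_ge0 ?ltW.
  by rewrite ler_wpM2l ?(ltW p0)// lef_pV2 ?posrE ?mulr_gt0// ltW.
have -> : c *: v = (2 * c * a / p) *: ((p / (2 * a)) *: v).
  by rewrite scalerA; congr (_ *: _); field; rewrite !gt_eqF.
apply: (@le_trans _ _ (Psi (r *: ((p / (2 * a)) *: v)))).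
  apply: condC_homo; first by rewrite divr_ge0 ?mulr_ge0 ?(ltW a0) ?(ltW p0).
  by rewrite ler_pdivrMr.
apply: le_trans (condG_le _ r0) _.
rewrite [leRHS]mulrAC; apply: ler_wpM2l => //.
by rewrite mulr_ge0// addr_ge0 ?powR_ge0.
Qed.

End OrliczGauge.

(** * Real integrals and a comparison for lower integrals *)

Section Integrals.
Context d {T : measurableType d} {R : realType} (mu : probability T R).

Lemma bounded_measurable_integrable (g : T -> R) (M : R) :
  measurable_fun setT g -> (forall x, `|g x| <= M) ->
  mu.-integrable setT (EFin \o g).
Proof.
move=> mg gM; apply: measurable_bounded_integrable => //.
  exact: (le_lt_trans (probability_le1 mu measurableT) (ltry _)).
apply: filterS (nbhs_pinfty_ge (num_real M)) => N MN x _.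
exact: le_trans (gM x) MN.
Qed.

Lemma EFin_Rintegral (g : T -> R) : mu.-integrable setT (EFin \o g) ->
  (\int[mu]_x (g x)%:E)%E = (\int[mu]_x g x)%:E.
Proof. by move=> ig; rewrite /Rintegral fineK//; exact: integrable_fin_num. Qed.

Lemma Rintegral_probability_cst (r : R) : \int[mu]_x r = r.
Proof.
rewrite Rintegral_cst// [X in fine X](_ : _ = 1%E) ?mulr1//.
exact: probability_setT.
Qed.

(* For a nonmeasurable [b] the library integral is the lower integral, which
   is still additive against the measurable summand [w]. *)
Lemma le_lower_integral (F b w : T -> R) (k : R) : 0 < k ->
  (forall x, 0 <= F x) -> (forall x, 0 <= b x) -> (forall x, 0 <= w x) ->
  measurable_fun setT w -> (forall x, F x <= k * b x + w x) ->
  (\int[mu]_x (F x)%:E <= k%:E * \int[mu]_x (b x)%:E + \int[mu]_x (w x)%:E)%E.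
Proof.
move=> k0 F0 b0 w0 mw Fbw.
rewrite [leLHS]ge0_integralTE; last by move=> x; rewrite lee_fin.
apply: ge_ereal_sup => _ [phi /= phiF <-].
(* [psi] is measurable whether or not [b] is, and lies below [b], so its integral bounds that of [b]
   from below. *)
pose psi x := Num.max (phi x - w x) 0 / k.
have mphi : measurable_fun setT (phi : T -> R) by exact: measurable_funP.
have mpsi : measurable_fun setT psi.
  apply: measurable_funM; last exact: measurable_cst.
  by apply: measurable_maxr => //; exact: measurable_funB.
have psi0 x : 0 <= psi x by rewrite divr_ge0 ?(ltW k0)// le_max lexx orbT.
have psib x : psi x <= b x.
  rewrite ler_pdivrMr// ge_max mulr_ge0 ?(ltW k0)// andbT mulrC lerBlDr.
  by apply: le_trans (Fbw x); rewrite -lee_fin.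
have psile : (\int[mu]_x (psi x)%:E <= \int[mu]_x (b x)%:E)%E.
  rewrite !ge0_integralTE; try by move=> x; rewrite lee_fin.
  apply: ereal_sup_le => _ [h hpsi <-]; exists h => //= x.
  by apply: le_trans (hpsi x) _; rewrite lee_fin.
rewrite (_ : sintegral mu phi = \int[mu]_x (phi x)%:E)%E; last first.
  by rewrite integral_nnsfun// patch_setT.
apply: (@le_trans _ _ (\int[mu]_x (k%:E * (psi x)%:E + (w x)%:E))%E).
  apply: ge0_le_integral => //.
  - by move=> x _; rewrite lee_fin fun_ge0.
  - exact/measurable_EFinP.
  - apply: emeasurable_funD; last exact/measurable_EFinP.
    by apply/measurable_EFinP; apply: measurable_funM => //; exact: measurable_cst.
  - move=> x _; rewrite -EFinM -EFinD lee_fin /psi mulrCA divff ?gt_eqF// mulr1.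
    by rewrite -lerBlDr le_max lexx.
rewrite ge0_integralD//; first last.
- exact/measurable_EFinP.
- by move=> x _; rewrite lee_fin.
- by apply/measurable_EFinP; apply: measurable_funM => //; exact: measurable_cst.
- by move=> x _; rewrite -EFinM lee_fin mulr_ge0// ltW.
rewrite leeD2r// ge0_integralZl//; first last.
- by rewrite lee_fin ltW.
- by move=> x _; rewrite lee_fin.
- exact/measurable_EFinP.
by rewrite lee_wpmul2l// lee_fin ltW.
Qed.

End Integrals.

(** * A lower bound on the entropy of a square *)

Section Entropy.
Context {R : realType} (n : nat) (mu : probability (borelRn R n) R).

Lemma ln_ge1BV (y : R) : 0 < y -> 1 - y^-1 <= ln y.
Proof.
move=> y0; have yi : 0 < y^-1 by rewrite invr_gt0.
have := @le_ln1Dx R (y^-1 - 1); rewrite ltrBrDl subrr yi => /(_ isT).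
by rewrite addrC subrK lnV ?posrE//; lra.
Qed.

(** Jensen's inequality for [- ln] of [1 / h], under the probability of density [h ^+ 2 / H2] with
    respect to [mu], for which [1 / h] has mean [H1 / H2]. The bounds on [h] make all integrals
    finite. *)
Lemma Ent_sqr_ge (h : 'rV[R]_n -> R) (c M : R) : 0 < c ->
  measurable_fun setT (h : borelRn R n -> R) -> (forall x, c <= h x <= M) ->
  let H2 := \int[mu]_x (h x ^+ 2) in let H1 := \int[mu]_x h x in
  ((H2 * ln (H2 / H1 ^+ 2))%R%:E <= Ent mu (fun x => (h x ^+ 2)%R))%E.
Proof.
move=> c0 mh cM; set H2 := \int[mu]_x (h x ^+ 2); set H1 := \int[mu]_x h x; cbv zeta.
have h0 x : 0 < h x by apply: lt_le_trans c0 _; case/andP: (cM x).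
have hM x : h x <= M by case/andP: (cM x).
have ch x : c <= h x by case/andP: (cM x).
have M0 : 0 < M by exact: lt_le_trans (hM 0).
have ih : mu.-integrable setT (EFin \o h).
  by apply: (@bounded_measurable_integrable _ _ _ _ _ M) => // x; rewrite gtr0_norm.
have mh2 : measurable_fun setT (fun x : borelRn R n => h x ^+ 2) by exact: measurable_funX.
have ih2 : mu.-integrable setT (EFin \o (fun x => h x ^+ 2)).
  apply: (@bounded_measurable_integrable _ _ _ _ _ (M ^+ 2)) => // x.
  by rewrite gtr0_norm ?exprn_gt0// lerXn2r ?nnegrE ?(ltW (h0 _)) ?(ltW M0).
have mlh : measurable_fun setT (fun x : borelRn R n => h x ^+ 2 * ln (h x ^+ 2)).
  apply: measurable_funM => //.
  exact: (@measurableT_comp _ _ _ _ _ _ (@ln R) _ _ (@measurable_ln R) mh2).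
have ilh : mu.-integrable setT (EFin \o (fun x => h x ^+ 2 * ln (h x ^+ 2))).
  apply: (@bounded_measurable_integrable _ _ _ _ _
    (M ^+ 2 * (`|ln (c ^+ 2)| + `|ln (M ^+ 2)|))) => // x.
  rewrite normrM; apply: ler_pM => //.
    by rewrite gtr0_norm ?exprn_gt0// lerXn2r ?nnegrE ?(ltW (h0 _)) ?(ltW M0).
  have l1 : ln (c ^+ 2) <= ln (h x ^+ 2).
    by rewrite ler_ln ?posrE ?exprn_gt0// lerXn2r ?nnegrE ?(ltW c0) ?(ltW (h0 _)) ?(ltW M0).
  have l2 : ln (h x ^+ 2) <= ln (M ^+ 2).
    by rewrite ler_ln ?posrE ?exprn_gt0// lerXn2r ?nnegrE ?(ltW c0) ?(ltW (h0 _)) ?(ltW M0).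
  rewrite ler_norml; apply/andP; split.
    have := ler_norm (- ln (c ^+ 2)); have := normr_ge0 (ln (M ^+ 2)).
    rewrite normrN; lra.
  have := ler_norm (ln (M ^+ 2)); have := normr_ge0 (ln (c ^+ 2)); lra.
have H10 : 0 < H1.
  apply: lt_le_trans c0 _; rewrite -(Rintegral_probability_cst mu c).
  apply: le_Rintegral => //.
  exact: finite_measure_integrable_cst.
have H20 : 0 < H2.
  apply: (@lt_le_trans _ _ (c ^+ 2)); first by rewrite exprn_gt0.
  rewrite -(Rintegral_probability_cst mu (c ^+ 2)).
  apply: le_Rintegral => //; first exact: finite_measure_integrable_cst.
  by move=> x _; rewrite lerXn2r ?nnegrE ?(ltW c0) ?(ltW (h0 _)) ?(ltW M0).
rewrite /Ent unlock (EFin_Rintegral ih2) (EFin_Rintegral ilh) -/H2 lne_EFin//.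
rewrite -EFinM -EFinB lee_fin.
(* The bound [1 - 1 / y <= ln y] is used at [y = h x * H1 / H2]. Multiplied by [2 * h x ^+ 2] and
   shifted by [l * h x ^+ 2], its left side is a quadratic polynomial in [h x] whose integral is
   [l * H2]. *)
pose l := ln (H2 ^+ 2 / H1 ^+ 2).
have ib : mu.-integrable setT
    (EFin \o (fun x => (l + 2) * h x ^+ 2 + - (2 * (H2 / H1)) * h x)).
  exact: (integrableD measurableT (integrableZl measurableT (l + 2) ih2)
    (integrableZl measurableT (- (2 * (H2 / H1))) ih)).
have := @le_Rintegral _ _ _ mu setT _ _ measurableT ib ilh.
rewrite RintegralD//; first last.
- exact: (integrableZl measurableT (- (2 * (H2 / H1))) ih).
- exact: (integrableZl measurableT (l + 2) ih2).
rewrite !RintegralZl// -/H2 -/H1.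
have -> : - (2 * (H2 / H1)) * H1 = - (2 * H2) by field; rewrite gt_eqF.
have -> : ln (H2 / H1 ^+ 2) = l - ln H2.
  rewrite /l -ln_div ?posrE ?divr_gt0 ?exprn_gt0//; congr ln; field.
  by rewrite !gt_eqF.
suff P x : (l + 2) * h x ^+ 2 + - (2 * (H2 / H1)) * h x <= h x ^+ 2 * ln (h x ^+ 2).
  by move=> /(_ (fun x _ => P x)); lra.
have hx := h0 x.
have y0 : 0 < h x * H1 / H2 := divr_gt0 (mulr_gt0 hx H10) H20.
have := ln_ge1BV y0.
have -> : ln (h x ^+ 2) = l + 2 * ln (h x * H1 / H2).
  rewrite mulr_natl -lnXn// /l -lnM ?posrE ?(exprn_gt0 _ y0)//; last first.
    by rewrite divr_gt0 ?exprn_gt0.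
  by congr ln; field; rewrite !gt_eqF.
move=> lb.
have -> : (l + 2) * h x ^+ 2 + - (2 * (H2 / H1)) * h x =
   h x ^+ 2 * (l + 2 * (1 - (h x * H1 / H2)^-1)) by field; rewrite !gt_eqF.
by rewrite ler_pM2l ?exprn_gt0//; lra.
Qed.

End Entropy.

(** * The modified log-Sobolev inequality tested on powers of the truncation *)

Section MomentRatio.
Context {R : realType}.

(** If [u <= v] the first factor is at most 1. Otherwise the exponent [s] may be raised to [q],
    which leaves [u] to the power [q], at most 1 or at most the power [p] of [u]. *)
Lemma powR_div_young (u v s q p : R) : 0 <= u -> 0 < v -> 0 < s -> s <= q ->
  q <= p -> (u / v) `^ s * v `^ q <= 1 + u `^ p + v `^ q.
Proof.
move=> u0 v0 s0 sq qp; have q0 : 0 < q by exact: lt_le_trans sq.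
have [uv|vu] := leP u v.
  apply: (@le_trans _ _ (v `^ q)); last by rewrite lerDr addr_ge0// powR_ge0.
  rewrite ler_piMl ?powR_ge0// -[leRHS](_ : 1 `^ s = 1); last by rewrite powR1.
  apply: ge0_ler_powR; rewrite ?nnegrE ?(ltW s0)//.
    by rewrite divr_ge0// ltW.
  by rewrite ler_pdivrMr// mul1r.
apply: (@le_trans _ _ (u `^ q)).
  apply: (@le_trans _ _ ((u / v) `^ q * v `^ q)).
    rewrite ler_wpM2r ?powR_ge0//; apply: ler_powR => //.
    by rewrite ler_pdivlMr// mul1r ltW.
  rewrite -powRM ?(ltW v0)//; last by rewrite divr_ge0// ltW.
  by rewrite divfK ?gt_eqF.
apply: (@le_trans _ _ (1 + u `^ p)); last by rewrite lerDl powR_ge0.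
have [u1|u1] := leP u 1.
  apply: (@le_trans _ _ 1); last by rewrite lerDl powR_ge0.
  rewrite -[leRHS](_ : 1 `^ q = 1); last by rewrite powR1.
  apply: ge0_ler_powR; rewrite ?nnegrE ?(ltW q0)//.
by apply: (@le_trans _ _ (u `^ p)); [exact/ler_powR/qp/ltW|rewrite lerDr].
Qed.

Context (n : nat) (alpha beta K D p : R) (Psi : 'rV[R]_n -> R)
  (mu : probability (borelRn R n) R) (f : 'rV[R]_n -> R) (A e m : R).
Hypotheses (alpha1 : 1 < alpha) (alphabeta : alpha <= beta) (K1 : 1 <= K)
  (D0 : 0 < D) (CPsi : condC Psi) (GPsi : condG Psi K alpha beta)
  (mlsi : mLSI mu Psi D) (lf : loc_lipschitz f) (A0 : 0 < A)
  (e0 : 0 < e) (e1 : e < 1).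

Let z x := trunc_sqr e m (f x).
Let z_gt0 x : 0 < z x. Proof. exact: trunc_sqr_gt0. Qed.

(** The exponent is halved because [trunc_sqr] stands for the square of [(f - m)_+]; this is the
    truncated moment of order [q]. *)
Definition trunc_moment (q : R) : R :=
  \int[mu]_x (trunc_sqr e m (f x) `^ (q / 2)).

Lemma measurable_trunc (r : R) : 0 < r ->
  measurable_fun setT (fun x : borelRn R n => trunc_sqr e m (f x) `^ r).
Proof.
move=> r0; apply: continuous_measurable_borelRn.
exact: (loc_lipschitz_continuous (loc_lipschitz_trunc m lf e0 e1 r0)).
Qed.

Lemma trunc_powR_bound (r : R) x : 0 < r ->
  e `^ r <= trunc_sqr e m (f x) `^ r <= e^-1 `^ r.
Proof.
move=> r0; apply/andP; split; apply: ge0_ler_powR;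
  rewrite ?nnegrE ?invr_ge0 ?(ltW r0) ?(ltW e0) ?(ltW (z_gt0 _))//.
- exact: trunc_sqr_ge.
- exact: trunc_sqr_le.
Qed.

Lemma integrable_trunc (r : R) : 0 < r ->
  mu.-integrable setT (EFin \o (fun x => trunc_sqr e m (f x) `^ r)).
Proof.
move=> r0; apply: (@bounded_measurable_integrable _ _ _ _ _ (e^-1 `^ r)).
  exact: measurable_trunc.
move=> x; rewrite ger0_norm ?powR_ge0//.
by have /andP[] := trunc_powR_bound x r0.
Qed.

Lemma trunc_moment_gt0 q : 0 < q -> 0 < trunc_moment q.
Proof.
move=> q0; have q2 : 0 < q / 2 by rewrite divr_gt0.
apply: (@lt_le_trans _ _ (e `^ (q / 2))); first exact: powR_gt0.
rewrite -(Rintegral_probability_cst mu (e `^ (q / 2))).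
apply: le_Rintegral => //; first exact: finite_measure_integrable_cst.
  exact: integrable_trunc.
by move=> x _; have /andP[] := trunc_powR_bound x q2.
Qed.

Hypothesis hA :
  (\int[mu]_x (Psi_norm Psi p (grad f x) `^ p)%:E <= (A `^ p)%:E)%E.

(** The test function is [h], the power [q / 4] of the truncation: [h ^+ 2] integrates to the moment
    of order [q], and [h] to that of order [q / 2], as the entropy bound requires. The constant 3
    bounds the integral of [1 + u^p + v^q] for the normalised [u] and [v] below. *)
Lemma trunc_moment_ratio q : beta <= q -> q <= p ->
  ln (trunc_moment q / trunc_moment (q / 2) ^+ 2) <=
  3 * D * K * p * ((q / p * (A / trunc_moment q `^ q^-1)) `^ alpha +
                   (q / p * (A / trunc_moment q `^ q^-1)) `^ beta).
Proof.
move=> bq qp.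
have q0 : 0 < q by apply: lt_le_trans bq; apply: lt_le_trans alphabeta; apply: lt_trans alpha1.
have p0 : 0 < p by exact: lt_le_trans qp.
have K0 : 0 < K by exact: lt_le_trans K1.
have q2 : 0 < q / 2 by rewrite divr_gt0.
have q4 : 0 < q / 4 by rewrite divr_gt0.
have alpha0 : 0 < alpha by exact: lt_trans alpha1.
have beta0 : 0 < beta by exact: lt_le_trans alphabeta.
set M := trunc_moment q; set G := M `^ q^-1.
have M0 : 0 < M by exact: trunc_moment_gt0.
have G0 : 0 < G by exact: powR_gt0.
have GM : G `^ q = M by rewrite /G -powRrM mulVf ?gt_eqF// powRr1// ltW.
set X := q / p * (A / G).
have X0 : 0 < X by rewrite mulr_gt0 ?divr_gt0.
set S := X `^ alpha + X `^ beta.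
have S0 : 0 < S by rewrite addr_gt0 ?powR_gt0.
pose h x := z x `^ (q / 4).
have hh x : h x ^+ 2 = z x `^ (q / 2).
  rewrite /h -powR_mulrn ?powR_ge0// -powRrM.
  by congr (_ `^ _); lra.
have h0 x : 0 < h x by exact: powR_gt0.
have hE (y : 'rV[R]_n) : e `^ (q / 4) <= h y <= e^-1 `^ (q / 4).
  exact: trunc_powR_bound.
have mh : measurable_fun setT (h : borelRn R n -> R) by exact: measurable_trunc.
have eq4 : 0 < e `^ (q / 4) by exact: powR_gt0.
have := Ent_sqr_ge mu eq4 mh (fun x => hE x).
rewrite (_ : \int[mu]_x h x ^+ 2 = M); last first.
  by apply: eq_Rintegral => x _; rewrite hh.
rewrite (_ : \int[mu]_x h x = trunc_moment (q / 2)); last first.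
  by apply: eq_Rintegral => x _; rewrite /h; congr (_ `^ _); lra.
move=> entlb.
have bh : bounded_fun h.
  apply: filterS (nbhs_pinfty_ge (num_real (e^-1 `^ (q / 4)))) => N MN x _ /=.
  rewrite ger0_norm; last exact: ltW.
  by apply: le_trans MN; have /andP[] := hE x.
have entub := mlsi h0 bh (loc_lipschitz_trunc m lf e0 e1 q4).
pose a x := Psi_norm Psi p (grad f x).
have a0 x : 0 <= a x by exact: Psi_norm_ge0.
pose k := K * p * S * M.
have k0 : 0 < k by rewrite !mulr_gt0.
have Fle x : Psi ((h x)^-1 *: grad h x) * h x ^+ 2 <=
    k / A `^ p * a x `^ p + k * (1 + z x `^ (q / 2) / M).
  have [c /andP[c0 cle] ->] := grad_trunc m lf e0 e1 q4 x.
  have g0 : 0 < z x `^ 2^-1 by exact: powR_gt0.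
  set g := z x `^ 2^-1 in cle g0.
  have gq : z x `^ (q / 2) = g `^ q by rewrite /g -powRrM mulrC.
  (* From [c <= q / (2 * g)] follows [2 * c * a x <= r * p], the hypothesis of [Psi_norm_growth]. *)
  pose r := q / p * (a x / g).
  have := @Psi_norm_growth R n Psi K alpha beta p CPsi GPsi K1 p0 (grad f x) c r c0.
  have -> : 2 * c * Psi_norm Psi p (grad f x) <= r * p.
    have -> : r * p = 2 * (2 * (q / 4) / g) * a x by rewrite /r; field; rewrite !gt_eqF.
    by apply: ler_wpM2r; [exact: a0|rewrite ler_pM2l].
  move=> /(_ isT) Psile.
  rewrite hh gq; apply: (@le_trans _ _ (K * p * (r `^ alpha + r `^ beta) * g `^ q)).
    by rewrite ler_wpM2r// powR_ge0.
  (* Normalisation: [u^p] has integral at most 1 by [hA], [v^q] has integral 1, and [r] is [X] times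
     [u / v]. *)
  pose u := a x / A; pose v := g / G.
  have u0 : 0 <= u by rewrite divr_ge0// ltW.
  have v0 : 0 < v by rewrite divr_gt0.
  have rE : r = X * (u / v) by rewrite /r /X /u /v; field; rewrite !gt_eqF.
  have gE : g `^ q = M * v `^ q.
    by rewrite -GM -powRM ?(ltW G0) ?(ltW v0)// /v mulrC divfK ?gt_eqF.
  have term s : 0 < s -> s <= q ->
      r `^ s * g `^ q <= X `^ s * M * (1 + u `^ p + v `^ q).
    move=> s0 sq; rewrite rE (powRM _ (ltW X0) (divr_ge0 u0 (ltW v0))) gE.
    rewrite mulrACA ler_pM2l ?mulr_gt0 ?powR_gt0//.
    exact: powR_div_young.
  have -> : k / A `^ p * a x `^ p + k * (1 + g `^ q / M) =
     K * p * ((X `^ alpha * M) * (1 + u `^ p + v `^ q) +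
              (X `^ beta * M) * (1 + u `^ p + v `^ q)).
    have -> : v `^ q = g `^ q / M by rewrite gE mulrC mulKf ?gt_eqF.
    have -> : u `^ p = a x `^ p / A `^ p.
      rewrite /u powRM ?invr_ge0 ?(ltW A0)//.
      by rewrite -powR_inv1 ?(ltW A0)// -powRrM mulN1r powRN.
    by rewrite /k /S; ring.
  rewrite -mulrA ler_pM2l ?mulr_gt0// mulrDl lerD// term//.
  exact: le_trans bq.
have mz : measurable_fun setT (fun x : borelRn R n => z x `^ (q / 2)).
  exact: measurable_trunc.
have iz := integrable_trunc q2.
have iw1 : mu.-integrable setT (EFin \o (fun x => 1 + M^-1 * z x `^ (q / 2))).
  exact: (integrableD measurableT (finite_measure_integrable_cst mu 1 measurableT)
    (integrableZl measurableT M^-1 iz)).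
have iw : mu.-integrable setT (EFin \o (fun x => k * (1 + z x `^ (q / 2) / M))).
  have -> : (fun x => k * (1 + z x `^ (q / 2) / M)) =
            (fun x => k * (1 + M^-1 * z x `^ (q / 2))).
    by apply/funext => x; rewrite [_ / M]mulrC.
  exact: (integrableZl measurableT k iw1).
have wint : (\int[mu]_x (k * (1 + z x `^ (q / 2) / M))%:E = (2 * k)%:E)%E.
  rewrite (EFin_Rintegral iw); congr EFin.
  rewrite (_ : \int[mu]_x (k * (1 + z x `^ (q / 2) / M)) =
               \int[mu]_x (k * (1 + M^-1 * z x `^ (q / 2)))); last first.
    by apply: eq_Rintegral => x _; rewrite [_ / M]mulrC.
  rewrite RintegralZl// RintegralD//; first last.
  - exact: (integrableZl measurableT M^-1 iz).
  - exact: (finite_measure_integrable_cst mu 1 measurableT).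
  rewrite Rintegral_probability_cst RintegralZl// -/(trunc_moment q) -/M.
  by rewrite mulVf ?gt_eqF// mulrC.
have kA : 0 < k / A `^ p by rewrite divr_gt0// powR_gt0.
have PsiF x : 0 <= Psi ((h x)^-1 *: grad h x) * h x ^+ 2.
  rewrite mulr_ge0 ?sqr_ge0//.
  have [->|y0] := eqVneq ((h x)^-1 *: grad h x) 0; first by rewrite (condC1_0 CPsi).
  exact/ltW/(condC2 CPsi).
(* Measurability of [a] is not at hand, so only the summand built from [z] is split off as a
   measurable function. *)
have := @le_lower_integral _ _ _ mu _ (fun x => a x `^ p) _ _ kA PsiF
  (fun x => powR_ge0 _ _) _ _ Fle.
have w0 x : 0 <= k * (1 + z x `^ (q / 2) / M).
  by rewrite mulr_ge0 ?(ltW k0)// addr_ge0// divr_ge0 ?powR_ge0 ?(ltW M0).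
have mw : measurable_fun setT (fun x : borelRn R n => k * (1 + z x `^ (q / 2) / M)).
  by have /integrableP[/measurable_EFinP] := iw.
move=> /(_ w0 mw); rewrite wint => lower.
have {}lower : (\int[mu]_x (Psi ((h x)^-1 *: grad h x) * h x ^+ 2)%R%:E <= (3 * k)%:E)%E.
  apply: le_trans lower _.
  apply: (@le_trans _ _ ((k / A `^ p)%:E * (A `^ p)%:E + (2 * k)%:E)%E).
    by rewrite leeD2r// lee_wpmul2l// lee_fin ltW.
  rewrite -EFinM -EFinD lee_fin divfK ?gt_eqF ?powR_gt0//; lra.
have : (M * ln (M / trunc_moment (q / 2) ^+ 2) <= D * (3 * k)).
  rewrite -lee_fin; apply: le_trans entlb _; apply: le_trans entub _.
  by rewrite EFinM lee_wpmul2l// lee_fin ltW.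
have -> : D * (3 * k) = M * (3 * D * K * p * S) by rewrite /k; ring.
by rewrite ler_pM2l.
Qed.

End MomentRatio.

(** * From the ratio inequality to a moment bound, by halving the exponent *)

Section Bootstrap.
Context {R : realType}.

(** Inverts [2^x >= 1 + x * ln 2 >= 1 + x / 2]. At [x = alpha - 1] it bounds the ratio of the
    geometric series away from 1, and so produces the factor [1 / (alpha - 1)]. *)
Lemma powR2N_le (x : R) : 0 <= x <= 1 -> 2 `^ (- x) <= 1 - x / 4.
Proof.
move=> /andP[x0 x1]; rewrite powRN.
have l2 : 2^-1 <= ln (2 : R) by have := @ln_ge1BV R 2 ltac:(lra); lra.
have h : 1 + x / 2 <= 2 `^ x.
  rewrite /powR gt_eqF//; apply: le_trans (expR_ge1Dx _).
  by rewrite lerD2l ler_wpM2l.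
have h0 : 0 < 1 + x / 2 by lra.
apply: (@le_trans _ _ (1 + x / 2)^-1).
  by rewrite lef_pV2 ?posrE// powR_gt0.
by rewrite -[leLHS]mul1r ler_pdivrMr//; nra.
Qed.

(** Absorbs the root of order [beta] of [beta] into a universal constant, so that only the root of
    order [alpha] appears in the final bound. *)
Lemma powR_self_inv_le (x : R) : 1 <= x -> x `^ x^-1 <= expR 1.
Proof.
move=> x1; have x0 : 0 < x by lra.
rewrite /powR gt_eqF// ler_expR mulrC ler_pdivrMr// mul1r ltW//.
exact: ln_sublinear.
Qed.

(** [a / b ^+ 2] is the [q]-th power of the quotient [y] of the two roots, and
    [ln y >= 1 - 1 / y]. *)
Lemma ln_root_ratio (q a b : R) : 0 < q -> 0 < a -> 0 < b ->
  q * (1 - b `^ (q / 2)^-1 / a `^ q^-1) <= ln (a / b ^+ 2).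
Proof.
move=> q0 a0 b0.
have G0 : 0 < a `^ q^-1 by exact: powR_gt0.
have H0 : 0 < b `^ (q / 2)^-1 by exact: powR_gt0.
have := ln_ge1BV (divr_gt0 G0 H0); rewrite invf_div -(ler_pM2l q0) => /le_trans; apply.
rewrite !ln_div ?posrE ?exprn_gt0// !ln_powR lnXn// invf_div mulr2n.
by rewrite le_eqVlt; apply/orP; left; apply/eqP; field; rewrite gt_eqF.
Qed.

(** Take roots of order [s] and solve for [G]. As [q / p <= 1], it is at most its own root of order
    [s]; this cancels the root of [p] and leaves that of [q <= 2 * beta]. The constant is 36 = 18 *
    2. *)
Lemma root_of_powR_ge1 (q p beta kappa A G s : R) : 0 < q -> q <= p ->
  q <= 2 * beta -> 0 < kappa -> 0 < A -> 0 < G -> 1 <= s ->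
  1 <= 18 * kappa * p * (q / p * (A / G)) `^ s ->
  G <= 36 * A * (kappa `^ s^-1 * beta `^ s^-1).
Proof.
move=> q0 qp qb k0 A0 G0 s1 H.
have s0 : 0 < s by lra.
have p0 : 0 < p by exact: lt_le_trans qp.
have b0 : 0 < beta by lra.
have si0 : 0 <= s^-1 by rewrite invr_ge0 ltW.
have si1 : s^-1 <= 1 by rewrite invf_le1.
have X0 : 0 < q / p * (A / G) by rewrite mulr_gt0 ?divr_gt0.
have : 1 <= (18 * kappa * p * (q / p * (A / G)) `^ s) `^ s^-1.
  rewrite -[leLHS](_ : 1 `^ s^-1 = 1); last by rewrite powR1.
  by apply: ge0_ler_powR; rewrite ?nnegrE//; apply: le_trans H.
rewrite powRM ?powR_ge0//; last by rewrite !mulr_ge0 ?ltW.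
rewrite -powRrM divff ?gt_eqF// (powRr1 (ltW X0)).
rewrite powRM ?(ltW p0)//; last by rewrite mulr_ge0 ?(ltW k0).
rewrite powRM ?(ltW k0)// => H1.
have H2 : G <= 18 `^ s^-1 * kappa `^ s^-1 * (p `^ s^-1 * (q / p)) * A.
  rewrite -[leLHS]mul1r -ler_pdivlMr//.
  apply: le_trans H1 _; rewrite le_eqVlt; apply/orP; left; apply/eqP.
  by field; rewrite !gt_eqF.
apply: le_trans H2 _.
have e18 : 18 `^ s^-1 <= 18 :> R.
  by rewrite -[leRHS]powRr1//; apply: ler_powR => //; lra.
have eqp : p `^ s^-1 * (q / p) <= 2 * beta `^ s^-1.
  apply: (@le_trans _ _ (q `^ s^-1)).
    have qp1 : q / p <= (q / p) `^ s^-1.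
      by apply: ger1_powR => //; rewrite divr_gt0//= ler_pdivrMr// mul1r.
    apply: le_trans (ler_wpM2l (powR_ge0 _ _) qp1) _.
    by rewrite -(powRM _ (ltW p0) (divr_ge0 (ltW q0) (ltW p0))) mulrC divfK ?gt_eqF.
  apply: (@le_trans _ _ ((2 * beta) `^ s^-1)).
    by apply: ge0_ler_powR; rewrite ?nnegrE ?(ltW q0)//; lra.
  rewrite powRM ?(ltW b0)//; apply: ler_wpM2r; first exact: powR_ge0.
  by rewrite -[leRHS]powRr1//; apply: ler_powR => //; lra.
have K0 : 0 <= kappa `^ s^-1 by exact: powR_ge0.
have -> : 36 * A * (kappa `^ s^-1 * beta `^ s^-1) =
  18 * kappa `^ s^-1 * (2 * beta `^ s^-1) * A by ring.
rewrite ler_pM2r//; apply: ler_pM => //.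
- by rewrite mulr_ge0 ?powR_ge0.
- by rewrite mulr_ge0 ?powR_ge0// divr_ge0 ?(ltW q0) ?(ltW p0).
- by rewrite ler_wpM2r.
Qed.

(** The factor [3 * kappa] is absorbed into the base of the power, which is then at most [T / G].
    Since [T / G <= 1] and [s >= 1], the power of [T / G] is at most [T / G] itself. *)
Lemma scaled_powR_le (kappa A T G s rho : R) : 0 < kappa -> 0 < A -> 0 < G ->
  0 <= rho -> 1 <= s -> 3 * A * kappa `^ s^-1 <= T -> T <= G ->
  3 * kappa * (rho * (A / G)) `^ s <= rho `^ s * (T / G).
Proof.
move=> k0 A0 G0 r0 s1 AT TG.
have s0 : 0 < s by lra.
have ks0 : 0 < kappa `^ s^-1 by exact: powR_gt0.
have T0 : 0 < T by apply: lt_le_trans AT; rewrite !mulr_gt0.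
rewrite (powRM _ r0 (divr_ge0 (ltW A0) (ltW G0))) mulrCA ler_wpM2l ?powR_ge0//.
have AG : 3 * kappa `^ s^-1 * (A / G) <= T / G.
  by rewrite mulrA ler_pM2r ?invr_gt0//; lra.
have TG1 : 0 < T / G <= 1 by rewrite divr_gt0//= ler_pdivrMr// mul1r.
apply: le_trans (ge1r_powR TG1 s1).
apply: (@le_trans _ _ ((3 * kappa `^ s^-1 * (A / G)) `^ s)); last first.
  apply: ge0_ler_powR; rewrite ?nnegrE ?(ltW s0)//.
  - by rewrite !mulr_ge0 ?invr_ge0 ?ltW.
  - by rewrite ltW//; case/andP: TG1.
have k3 : 0 <= 3 * kappa `^ s^-1 by rewrite mulr_ge0// ltW.
rewrite (powRM _ k3 (divr_ge0 (ltW A0) (ltW G0))).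
rewrite ler_wpM2r ?powR_ge0// powRM ?(ltW ks0)// -powRrM mulVf ?gt_eqF//.
rewrite (powRr1 (ltW k0)) ler_wpM2r ?(ltW k0)//.
by apply: le1r_powR => //; lra.
Qed.

Context (alpha beta kappa p A d : R) (M : R -> R).
Hypotheses (alpha1 : 1 < alpha) (alpha2 : alpha <= 2) (beta2 : 2 <= beta)
  (betap : beta <= p) (kappa0 : 0 < kappa) (A0 : 0 < A)
  (M_gt0 : forall q, 0 < q -> 0 < M q).
Let G q := M q `^ q^-1.
Hypothesis ratio : forall q, beta <= q -> q <= p ->
  ln (M q / M (q / 2) ^+ 2) <=
  3 * kappa * p * ((q / p * (A / G q)) `^ alpha + (q / p * (A / G q)) `^ beta).
Hypothesis base : forall q, beta <= q -> q <= p ->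
  M (q / 2) ^+ 2 <= 2 / 3 * M q \/ G q <= d.

Let ka := kappa `^ alpha^-1.
Let kb := kappa `^ beta^-1.
(** [T] is the threshold above which the halving step applies, [B] the bound in the initial range of
    exponents, and [c] the ratio of the geometric series of errors. *)
Let T := 3 * A * (ka + kb).
Let B := 36 * A * (ka * beta `^ alpha^-1 + expR 1 * kb).
Let c := 2 `^ (- (alpha - 1)) : R.

Let hyps : [/\ 1 < alpha, alpha <= 2, 2 <= beta & beta <= p].
Proof. by []. Qed.

Let p0 : 0 < p.
Proof. by apply: lt_le_trans betap; apply: lt_le_trans beta2. Qed.
Let ka0 : 0 < ka. Proof. exact: powR_gt0. Qed.
Let kb0 : 0 < kb. Proof. exact: powR_gt0. Qed.
Let T0 : 0 < T. Proof. by rewrite mulr_gt0 ?addr_gt0 ?mulr_gt0. Qed.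
Let G0 q : 0 < q -> 0 < G q. Proof. by move=> q0; apply/powR_gt0/M_gt0. Qed.

(** In the first alternative of [base] the logarithm is at least 1 - 2/3 = 1/3. One of the two terms
    on the right of [ratio] is then at least 1/6, whence the factor 18, and [root_of_powR_ge1]
    concludes. *)
Lemma bootstrap_start q : beta <= q -> q <= p -> q <= 2 * beta ->
  G q <= Num.max B d.
Proof.
have [al1 al2 be2 bp] := hyps.
move=> bq qp q2b; rewrite le_max.
have q0 : 0 < q by lra.
have [Mle|->] := base bq qp; last by rewrite orbT.
apply/orP; left.
have Mq := M_gt0 q0.
have Mq2 : 0 < M (q / 2) by apply: M_gt0; lra.
have l13 : 1 / 3 <= ln (M q / M (q / 2) ^+ 2).
  have y0 : 0 < M q / M (q / 2) ^+ 2 by rewrite divr_gt0 ?exprn_gt0.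
  apply: le_trans (ln_ge1BV y0); rewrite invf_div.
  have : M (q / 2) ^+ 2 / M q <= 2 / 3 by rewrite ler_pdivrMr.
  lra.
have := le_trans l13 (ratio bq qp).
set Xa := (_ `^ alpha); set Xb := (_ `^ beta) => H.
have [Ha|Ha] := leP 1 (18 * kappa * p * Xa).
  have := root_of_powR_ge1 q0 qp q2b kappa0 A0 (G0 q0) (ltW alpha1) Ha.
  move=> /le_trans; apply; rewrite /B ler_pM2l ?mulr_gt0// lerDl.
  by rewrite mulr_ge0 ?expR_ge0// ltW.
have Hb : 1 <= 18 * kappa * p * Xb by lra.
have := root_of_powR_ge1 q0 qp q2b kappa0 A0 (G0 q0) (_ : 1 <= beta) Hb.
have -> : 1 <= beta by lra.
move=> /(_ isT)/le_trans; apply; rewrite /B ler_pM2l ?mulr_gt0//.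
apply: (@le_trans _ _ (expR 1 * kb)).
  by rewrite mulrC ler_wpM2r ?(ltW kb0)//; apply: powR_self_inv_le; lra.
by rewrite lerDr mulr_ge0 ?powR_ge0.
Qed.

(** [ratio] is bounded below by [ln_root_ratio] and above by [scaled_powR_le]. Since [q / p <= 1],
    the power [beta] of it is dominated by the power [alpha], and dividing by [q] lowers the
    exponent to [alpha - 1]. *)
Lemma bootstrap_step q : beta <= q -> q <= p -> T <= G q ->
  G q <= G (q / 2) + 2 * T * (q / p) `^ (alpha - 1).
Proof.
have [al1 al2 be2 bp] := hyps.
move=> bq qp TG.
have q0 : 0 < q by lra.
have Mq := M_gt0 q0.
have Mq2 : 0 < M (q / 2) by apply: M_gt0; lra.
have Gq := G0 q0.
have r0 : 0 < q / p by rewrite divr_gt0.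
have r1 : q / p <= 1 by rewrite ler_pdivrMr// mul1r.
have := le_trans (ln_root_ratio q0 Mq Mq2) (ratio bq qp).
have Ta : 3 * A * kappa `^ alpha^-1 <= T.
  by rewrite /T ler_pM2l ?mulr_gt0// lerDl ltW.
have Tb : 3 * A * kappa `^ beta^-1 <= T.
  by rewrite /T ler_pM2l ?mulr_gt0// lerDr ltW.
have Ha := scaled_powR_le kappa0 A0 Gq (ltW r0) (ltW alpha1) Ta TG.
have Hb := scaled_powR_le kappa0 A0 Gq (ltW r0) (_ : 1 <= beta) Tb TG.
have {}Hb := Hb ltac:(lra).
have TG0 : 0 < T / G q by rewrite divr_gt0.
have rab : (q / p) `^ beta <= (q / p) `^ alpha.
  by apply: ger_powR; [rewrite r0 r1|lra].
have rE : (q / p) `^ alpha = (q / p) * (q / p) `^ (alpha - 1).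
  by rewrite mulr_powRB1 ?(ltW r0)//; lra.
have {}Hb := le_trans Hb (ler_wpM2r (ltW TG0) rab).
rewrite -/(G q) -/(G (q / 2)) => H.
have : q * (1 - G (q / 2) / G q) <= q * (2 * (q / p) `^ (alpha - 1) * (T / G q)).
  apply: le_trans H _.
  have -> : q * (2 * (q / p) `^ (alpha - 1) * (T / G q)) =
      p * (2 * ((q / p) `^ alpha * (T / G q))).
    by rewrite rE; field; rewrite !gt_eqF.
  have -> : forall x y : R, 3 * kappa * p * (x + y) = p * (3 * kappa * x + 3 * kappa * y).
    by move=> x y; ring.
  by rewrite ler_pM2l//; lra.
rewrite ler_pM2l// -(ler_pM2r Gq).
have -> : (1 - G (q / 2) / G q) * G q = G q - G (q / 2) by field; rewrite gt_eqF.
have -> : 2 * (q / p) `^ (alpha - 1) * (T / G q) * G q =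
  2 * T * (q / p) `^ (alpha - 1) by field; rewrite gt_eqF.
by rewrite lerBlDl.
Qed.

Let c1 : c <= 1 - (alpha - 1) / 4.
Proof. by have [? ? _ _] := hyps; apply: powR2N_le; lra. Qed.

(** The added term sums a geometric series: its value at [q / 2] is [c] times its value at [q], so
    adding the error of one halving step restores it exactly. [T] enters the maximum for exponents
    at which the step does not apply. *)
Lemma bootstrap_iter j q : beta <= q -> q <= p -> q < 2 ^+ j.+1 * beta ->
  G q <= Num.max T (Num.max B d) + 2 * T * (q / p) `^ (alpha - 1) / (1 - c).
Proof.
have [al1 al2 be2 bp] := hyps.
have cpos : 0 < 1 - c by have := c1; lra.
have rest q' : 0 <= 2 * T * (q' / p) `^ (alpha - 1) / (1 - c).
  by rewrite divr_ge0 ?(ltW cpos)// mulr_ge0 ?powR_ge0// mulr_ge0// ltW.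
elim: j q => [|j IH] q bq qp qj.
  apply: le_trans (bootstrap_start bq qp _) _; first by rewrite expr1 in qj; exact: ltW.
  by rewrite (@le_trans _ _ (Num.max T (Num.max B d)))// ?lerDl// le_max lexx orbT.
have [q2b|q2b] := leP q (2 * beta).
  apply: le_trans (bootstrap_start bq qp q2b) _.
  by rewrite (@le_trans _ _ (Num.max T (Num.max B d)))// ?lerDl// le_max lexx orbT.
have [GT|TG] := leP (G q) T.
  apply: le_trans GT _.
  by rewrite (@le_trans _ _ (Num.max T (Num.max B d)))// ?lerDl// le_max lexx.
apply: le_trans (bootstrap_step bq qp (ltW TG)) _.
have q0 : 0 < q by lra.
have := IH (q / 2).
have -> : beta <= q / 2 by lra.
have -> : q / 2 <= p by lra.
have -> : q / 2 < 2 ^+ j.+1 * beta by move: qj; rewrite exprS; lra.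
move=> /(_ isT isT isT).
have -> : (q / 2 / p) `^ (alpha - 1) = (q / p) `^ (alpha - 1) * c.
  rewrite mulrAC powRM ?divr_ge0 ?(ltW q0) ?(ltW p0)//; congr (_ * _).
  by rewrite /c -(@powR_inv1 R 2)// -powRrM mulN1r.
move: (Num.max _ _) ((q / p) `^ _) => m r H.
have -> : 2 * T * r / (1 - c) = 2 * T * (r * c) / (1 - c) + 2 * T * r.
  by field; rewrite gt_eqF.
by rewrite addrA lerD2r.
Qed.

Lemma bootstrap : G p <=
  (27 + 36 * expR 1) * A *
  ((alpha - 1)^-1 * kb + ((alpha - 1)^-1 + beta `^ alpha^-1) * ka) + Num.max d 0.
Proof.
have [al1 al2 be2 bp] := hyps.
have [j pj] : exists j : nat, p < 2 ^+ j.+1 * beta.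
  exists (Num.truncn p).
  have h1 : p < (Num.truncn p).+1%:R by exact: truncnS_gt.
  have h2 : (Num.truncn p).+1%:R <= 2 ^+ (Num.truncn p).+1 :> R.
    by rewrite -natrX ler_nat ltnW// ltn_expl.
  have h3 : 0 < 2 ^+ (Num.truncn p).+1 :> R by rewrite exprn_gt0.
  by nra.
apply: le_trans (bootstrap_iter betap (lexx p) pj) _.
rewrite divff ?gt_eqF// powR1 mulr1.
have a0 : 0 < alpha - 1 by lra.
(* [1 - c >= (alpha - 1) / 4], by [powR2N_le]. *)
have ca : 2 * T / (1 - c) <= 8 * T / (alpha - 1).
  have cpos : 0 < 1 - c by have := c1; lra.
  rewrite ler_pdivrMr// mulrAC ler_pdivlMr//.
  by have := c1; have := T0; nra.
set i := (alpha - 1)^-1 in ca *.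
have i1 : 1 <= i by rewrite invf_ge1//; lra.
set b := beta `^ alpha^-1.
have b0 : 0 < b by apply: powR_gt0; lra.
have E1 : 1 <= expR 1 :> R by rewrite -expR0 ler_expR.
have B0 : 0 <= B.
  by rewrite /B !mulr_ge0 ?(ltW A0)// addr_ge0 ?mulr_ge0 ?expR_ge0 ?(ltW ka0) ?(ltW kb0) ?powR_ge0.
have maxle : Num.max T (Num.max B d) <= T + B + Num.max d 0.
  have d0 : 0 <= Num.max d 0 by rewrite le_max lexx orbT.
  have dd : d <= Num.max d 0 by rewrite le_max lexx.
  by rewrite !ge_max; apply/andP; split; [|apply/andP; split]; have := T0; lra.
apply: le_trans (lerD maxle ca) _.
rewrite addrAC lerD2r.
(* As [i >= 1], the left side is at most [9 * T * i], and 27 = 9 * 3. *)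
have iT : T + 8 * T * i <= 27 * A * (i * (ka + kb)).
  by rewrite /T; have := mulr_gt0 A0 (addr_gt0 ka0 kb0); nra.
have BE : B <= 36 * expR 1 * A * (i * kb + b * ka).
  rewrite /B -/b.
  have -> : 36 * expR 1 * A * (i * kb + b * ka) =
    36 * A * (expR 1 * (ka * b) + expR 1 * kb * i) by ring.
  rewrite ler_pM2l ?mulr_gt0// lerD//.
    by rewrite ler_peMl// mulr_ge0 ?(ltW ka0) ?(ltW b0).
  by rewrite ler_peMr// mulr_ge0 ?expR_ge0// ltW.
have s0 : 0 <= A * (b * ka) by rewrite !mulr_ge0 ?(ltW A0) ?(ltW ka0) ?(ltW b0).
have s1 : 0 <= expR 1 * (A * (i * ka)) by rewrite !mulr_ge0 ?expR_ge0 ?(ltW A0) ?(ltW ka0)//; lra.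
have -> : (27 + 36 * expR 1) * A * (i * kb + (i + b) * ka) =
  27 * A * (i * (ka + kb)) + 36 * expR 1 * A * (i * kb + b * ka) +
  27 * (A * (b * ka)) + 36 * (expR 1 * (A * (i * ka))) by ring.
by have := lerD iT BE; lra.
Qed.

End Bootstrap.

(** * Use of the median in the initial range, and removal of the truncation *)

Section MedianBase.
Context {R : realType} (n : nat) (mu : probability (borelRn R n) R)
  (f : 'rV[R]_n -> R) (m : R).
Hypothesis lf : loc_lipschitz f.

Lemma measurable_superlevel (t : R) :
  measurable ([set x | t < f x] : set (borelRn R n)).
Proof.
apply: sub_sigma_algebra; rewrite /open_Rn /=.
have /continuousP cf := loc_lipschitz_continuous lf.
exact: (cf [set y | t < y] (@open_gt R t)).
Qed.

(** Off the set [E] of measure at most 1/2, the function with integral [H1] equals the small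
    constant [eta], so Cauchy-Schwarz on [E] gives about [H1 <= eta + sqrt (H2 / 2)]. Either [eta]
    is negligible and the first alternative holds, or [H2] itself is small. *)
Lemma median_trunc_moment (e q : R) : 0 < e -> e < 1 -> 2 <= q ->
  (mu [set x : borelRn R n | (m < f x)%R] <= (2^-1)%:E)%E ->
  trunc_moment mu f e m (q / 2) ^+ 2 <= 2 / 3 * trunc_moment mu f e m q \/
  trunc_moment mu f e m q `^ q^-1 <= 20 * e `^ 2^-1.
Proof.
move=> e0 e1 q2 med.
have q0 : 0 < q by lra.
have q4 : 0 < q / 2 / 2 by lra.
have q20 : 0 < q / 2 by lra.
set H2 := trunc_moment mu f e m q; set H1 := trunc_moment mu f e m (q / 2).
have H20 : 0 < H2 by exact: trunc_moment_gt0.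
have H10 : 0 < H1 by exact: trunc_moment_gt0.
pose S := Num.sqrt H2.
have S0 : 0 < S by rewrite sqrtr_gt0.
have SE : H2 = S ^+ 2 by rewrite sqr_sqrtr// ltW.
pose eta := e `^ (q / 2 / 2).
have eta0 : 0 < eta by exact: powR_gt0.
pose E := [set x : borelRn R n | m < f x].
have mE : measurable E by exact: measurable_superlevel.
have iE : mu.-integrable setT (EFin \o (\1_E : borelRn R n -> R)).
  exact: integrable_indic.
(* Cauchy-Schwarz is replaced by [h <= h^2 / (2 t) + t / 2]. The best [t] is [sqrt 2 * S]; with 7/5
   for [sqrt 2] the result, 99/140, is still below 5/7. *)
pose t := 7 / 5 * S.
have t0 : 0 < t by rewrite mulr_gt0// divr_gt0.
have i2 := integrable_trunc mu m lf e0 e1 q20.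
have i1 := integrable_trunc mu m lf e0 e1 q4.
have ib := integrableD measurableT
  (finite_measure_integrable_cst mu eta measurableT)
  (integrableD measurableT (integrableZl measurableT (2 * t)^-1 i2)
     (integrableZl measurableT (t / 2) iE)).
have pt x : trunc_sqr e m (f x) `^ (q / 2 / 2) <=
    eta + ((2 * t)^-1 * trunc_sqr e m (f x) `^ (q / 2) + t / 2 * \1_E x).
  have [fm|mf] := leP (f x) m.
    rewrite trunc_sqr_id// -/eta lerDl addr_ge0// mulr_ge0 ?powR_ge0//.
    - by rewrite invr_ge0 mulr_ge0// ltW.
    - by rewrite divr_ge0// ltW.
  rewrite indicE mem_set// mulr1.
  have -> : trunc_sqr e m (f x) `^ (q / 2) = (trunc_sqr e m (f x) `^ (q / 2 / 2)) ^+ 2.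
    by rewrite -powR_mulrn ?powR_ge0// -powRrM; congr (_ `^ _); lra.
  have : 0 <= trunc_sqr e m (f x) `^ (q / 2 / 2) by exact: powR_ge0.
  move: (_ `^ _) => h h0.
  suff : h <= (2 * t)^-1 * h ^+ 2 + t / 2 by lra.
  have -> : (2 * t)^-1 * h ^+ 2 + t / 2 = (h ^+ 2 + t ^+ 2) / (2 * t).
    by field; rewrite gt_eqF.
  rewrite ler_pdivlMr ?mulr_gt0//.
  by have := sqr_ge0 (h - t); rewrite sqrrB; lra.
have H1le : H1 <= eta + 5 / 7 * S.
  have := @le_Rintegral _ _ _ mu setT _ _ measurableT i1 ib (fun x _ => pt x).
  rewrite -/H1 => /le_trans; apply.
  rewrite RintegralD//; first last.
  - exact: (integrableD measurableT (integrableZl measurableT (2 * t)^-1 i2)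
     (integrableZl measurableT (t / 2) iE)).
  - exact: (finite_measure_integrable_cst mu eta measurableT).
  rewrite Rintegral_probability_cst RintegralD//; first last.
  - exact: (integrableZl measurableT (t / 2) iE).
  - exact: (integrableZl measurableT (2 * t)^-1 i2).
  rewrite !RintegralZl// -/(trunc_moment mu f e m q) -/H2.
  have muE : \int[mu]_x (\1_E x : R) <= 2^-1.
    by rewrite -lee_fin -(EFin_Rintegral iE) integral_indic// setIT.
  have -> : (2 * t)^-1 * H2 = 5 / 14 * S by rewrite SE /t; field; rewrite gt_eqF.
  have : t / 2 * \int[mu]_x (\1_E x : R) <= t / 2 * 2^-1.
    by rewrite ler_pM2l// divr_gt0.
  rewrite /t; lra.
(* The threshold works because 5/7 + 1/20 <= 4/5 and 16/25 <= 2/3. *)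
have [etaS|Seta] := leP eta (S / 20).
  left; rewrite SE.
  have : H1 <= 4 / 5 * S by lra.
  rewrite -(ler_pXn2r (_ : (0 < 2)%N)) ?nnegrE ?(ltW H10) ?mulr_ge0 ?(ltW S0)//.
  by rewrite exprMn; have := exprn_gt0 2 S0; lra.
right.
have S20 : S <= 20 * eta by lra.
have -> : H2 `^ q^-1 = S `^ (2 / q).
  by rewrite SE -powR_mulrn ?(ltW S0)// -powRrM.
apply: (@le_trans _ _ ((20 * eta) `^ (2 / q))).
  by apply: ge0_ler_powR; rewrite ?nnegrE ?divr_ge0 ?mulr_ge0 ?(ltW S0) ?(ltW q0) ?(ltW eta0).
rewrite powRM ?(ltW eta0)// /eta -powRrM.
have -> : q / 2 / 2 * (2 / q) = 2^-1 by field; rewrite gt_eqF.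
rewrite ler_wpM2r ?powR_ge0// -[leRHS]powRr1//; apply: ler_powR; first lra.
by rewrite ler_pdivrMr// mul1r.
Qed.

(** The integral is a supremum over simple functions, each of which is bounded; [e] is chosen after
    the simple function, so small that the cap of the truncation lies above it. *)
Lemma one_sided_moment (p B : R) : 0 < p -> 0 < B ->
  (forall e, 0 < e -> e < 1 ->
    trunc_moment mu f e m p `^ p^-1 <= B + 20 * e `^ 2^-1) ->
  (\int[mu]_x (Num.max (f x - m) 0 `^ p)%:E <= ((4 * B) `^ p)%:E)%E.
Proof.
move=> p0 B0 HB.
rewrite ge0_integralTE; last by move=> x; rewrite lee_fin powR_ge0.
apply: ge_ereal_sup => _ [phi /= phile <-].
have [N N1 phiN] : exists2 N : R, 1 <= N & forall x, phi x <= N.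
  have := simple_bounded phi; move=> /pinfty_ex_gt0[N0 N00 phiN].
  exists (1 + N0); first by rewrite lerDl ltW.
  move=> x; apply: (@le_trans _ _ N0); last by rewrite lerDr.
  by apply: le_trans (ler_norm _) _; exact: phiN.
have N0 : 0 < N by lra.
have Np0 : 0 < N `^ (2 / p) by exact: powR_gt0.
(* The three bounds ensure [e < 1], [20 * sqrt e <= B], and that the cap [e^-1] to the power [p / 2]
   is at least [N]. *)
pose e := Num.min 2^-1 (Num.min ((B / 20) ^+ 2) (N `^ (2 / p))^-1).
have e0 : 0 < e.
  rewrite !lt_min; apply/and3P; split; [lra| |by rewrite invr_gt0].
  by rewrite exprn_gt0// divr_gt0.
have e1 : e < 1 by rewrite !gt_min; apply/orP; left; lra.
have eN : N `^ (2 / p) <= e^-1.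
  by rewrite -[leLHS]invrK lef_pV2 ?posrE ?invr_gt0// !ge_min lexx !orbT.
have eB : 20 * e `^ 2^-1 <= B.
  have : e `^ 2^-1 <= ((B / 20) ^+ 2) `^ 2^-1.
    apply: ge0_ler_powR; rewrite ?nnegrE ?(ltW e0) ?sqr_ge0//.
    by rewrite !ge_min lexx !orbT.
  rewrite -powR_mulrn; last by rewrite divr_ge0// ltW.
  rewrite -powRrM divff// powRr1; last by rewrite divr_ge0// ltW.
  lra.
have pp2 : 0 < p / 2 by rewrite divr_gt0.
have iz := integrable_trunc mu m lf e0 e1 pp2.
set M := trunc_moment mu f e m p.
have M0 : 0 < M by exact: trunc_moment_gt0.
have Mle : M <= (2 * B) `^ p.
  have -> : M = (M `^ p^-1) `^ p by rewrite -powRrM mulVf ?gt_eqF// powRr1// ltW.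
  apply: ge0_ler_powR; rewrite ?nnegrE ?powR_ge0 ?(ltW p0) ?mulr_ge0 ?(ltW B0)//.
  by apply: le_trans (HB e e0 e1) _; lra.
have phiz x : phi x <= 2 `^ (p / 2) * trunc_sqr e m (f x) `^ (p / 2).
  have z0 : 0 <= trunc_sqr e m (f x) by exact/ltW/trunc_sqr_gt0.
  rewrite -powRM//.
  apply: (@le_trans _ _ (Num.min (pos_sqr (f x - m)) e^-1 `^ (p / 2))); last first.
    apply: ge0_ler_powR; first exact: ltW.
    - by rewrite nnegrE le_min pos_sqr_ge0 invr_ge0 ltW.
    - by rewrite nnegrE; apply: mulr_ge0.
    exact: trunc_sqr_ge_min.
  have [we|ew] := leP (pos_sqr (f x - m)) e^-1.
    have := phile x; rewrite lee_fin => /le_trans; apply.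
    rewrite /pos_sqr -powR_mulrn ?le_max ?lexx ?orbT// -powRrM.
    by rewrite (_ : 2 * (p / 2) = p)//; lra.
  apply: le_trans (phiN x) _.
  apply: (@le_trans _ _ ((N `^ (2 / p)) `^ (p / 2))).
    by rewrite -powRrM (_ : 2 / p * (p / 2) = 1) ?powRr1 ?(ltW N0)//; field; rewrite gt_eqF.
  by apply: ge0_ler_powR; rewrite ?nnegrE ?invr_ge0 ?(ltW pp2) ?(ltW Np0) ?(ltW e0).
rewrite (_ : sintegral mu phi = \int[mu]_x (phi x)%:E)%E; last first.
  by rewrite integral_nnsfun// patch_setT.
apply: (@le_trans _ _ (\int[mu]_x (2 `^ (p / 2) * trunc_sqr e m (f x) `^ (p / 2))%:E)%E).
  apply: ge0_le_integral => //.
  - by move=> x _; rewrite lee_fin fun_ge0.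
  - by apply/measurable_EFinP; exact: measurable_funP.
  - apply/measurable_EFinP; apply: measurable_funM; first exact: measurable_cst.
    exact: measurable_trunc.
  - by move=> x _; rewrite lee_fin.
rewrite EFin_Rintegral; last exact: (integrableZl measurableT (2 `^ (p / 2)) iz).
rewrite lee_fin RintegralZl// -/(trunc_moment mu f e m p) -/M.
apply: (@le_trans _ _ (2 `^ p * (2 * B) `^ p)); last first.
  by rewrite -powRM ?mulr_ge0 ?(ltW B0)// mulrA (_ : 2 * 2 = 4)//; lra.
apply: ler_pM => //; rewrite ?powR_ge0 ?(ltW M0)//.
apply: ler_powR; lra.
Qed.

End MedianBase.

(** * Existence of a median *)

Section Median.
Context d {T : measurableType d} {R : realType} (mu : probability T R).

Lemma measure_bigcup_le (F : nat -> set T) (c : \bar R) :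
  (forall k, measurable (F k)) -> {homo F : i j / (i <= j)%N >-> i `<=` j} ->
  (forall k, (mu (F k) <= c)%E) -> (mu (\bigcup_k F k) <= c)%E.
Proof.
move=> mF ndF Fc.
have mU : measurable (\bigcup_k F k) by exact: bigcupT_measurable.
have cvF : (mu \o F) k @[k --> \oo] --> mu (\bigcup_k F k).
  by apply: nondecreasing_cvg_mu => // i j ij; apply/subsetPset; exact: ndF.
rewrite -(cvg_lim _ cvF)//; apply: lime_le; first by apply/cvg_ex; eexists; exact: cvF.
exact: nearW.
Qed.

(** The median is the infimum of the levels in [A]. Both bounds reach it along increasing unions;
    the same continuity from below shows that [A] is neither empty nor everything, as the whole
    space would otherwise have measure at most 1/2. *)
Lemma exists_median (f : T -> R) :
  (forall t, measurable [set x | t < f x]) ->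
  exists m, (mu [set x | (m < f x)%R] <= (2^-1)%:E)%E /\
            (mu [set x | (f x < m)%R] <= (2^-1)%:E)%E.
Proof.
move=> mf.
have mfC t : measurable [set x | f x <= t].
  rewrite (_ : [set x | f x <= t] = ~` [set x | t < f x]); first exact: measurableC.
  by apply/seteqP; split => x /=; [rewrite leNgt => /negP|move/negP; rewrite -leNgt].
pose A := [set t : R | (mu [set x | (t < f x)%R] <= (2^-1)%:E)%E].
have notA t : ~ A t -> (mu [set x | (f x <= t)%R] <= (2^-1)%:E)%E.
  move=> /negP; rewrite -ltNge => h.
  rewrite (_ : [set x | f x <= t] = ~` [set x | t < f x]); last first.
    by apply/seteqP; split => x /=; [rewrite leNgt => /negP|move/negP; rewrite -leNgt].
  rewrite probability_setC//.
  have mfin : mu [set x | t < f x] \is a fin_num by exact: fin_num_measure.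
  move: h; rewrite -(fineK mfin) -EFinB lee_fin lte_fin; lra.
have Tle : ~ (mu setT <= (2^-1)%:E)%E.
  by rewrite probability_setT lee_fin => ?; lra.
have [a Aa] : exists a, A a.
  apply: contrapT => noA; apply: Tle.
  rewrite (_ : setT = \bigcup_k [set x | f x <= k%:R]).
    apply: measure_bigcup_le => //.
      by move=> i j ij x /= /le_trans; apply; rewrite ler_nat.
    by move=> k; apply: notA => Ak; apply: noA; exists k%:R.
  apply/esym/seteqP; split => // x _; exists (Num.truncn `|f x|).+1 => //=.
  exact: le_trans (ler_norm _) (ltW (truncnS_gt _)).
have [b nAb] : exists b, ~ A b.
  apply: contrapT => allA; apply: Tle.
  rewrite (_ : setT = \bigcup_k [set x | - k%:R < f x]).
    apply: measure_bigcup_le => //.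
      by move=> i j ij x /=; apply: le_lt_trans; rewrite lerN2 ler_nat.
    by move=> k; apply: contrapT => nA; apply: allA; exists (- k%:R).
  apply/esym/seteqP; split => // x _; exists (Num.truncn `|f x|).+1 => //=.
  rewrite ltrNl; apply: le_lt_trans (truncnS_gt _); rewrite -normrN; exact: ler_norm.
have Aup s t : A s -> s <= t -> A t.
  move=> As st; apply: le_trans As; apply: le_measure; rewrite ?inE//.
  by move=> x /=; exact: le_lt_trans.
have hinf : has_inf A.
  split; first by exists a.
  by exists b => t At; rewrite leNgt; apply/negP => tb; apply: nAb; apply: Aup At (ltW tb).
have k0 k : 0 < k.+1%:R^-1 :> R by rewrite invr_gt0.
exists (inf A); split.
  rewrite (_ : [set x | inf A < f x] = \bigcup_k [set x | inf A + k.+1%:R^-1 < f x]).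
    apply: measure_bigcup_le => //.
      by move=> i j ij x /=; apply: le_lt_trans; rewrite lerD2l lef_pV2 ?posrE// ler_nat.
    move=> k; have [t At tk] := inf_adherent (k0 k) hinf; exact: Aup At (ltW tk).
  apply/seteqP; split => x /=.
    rewrite -subr_gt0 => h.
    have [k _ /(_ k (leqnn _)) /= hk] := near_infty_natSinv_lt (PosNum h).
    by exists k => //=; rewrite addrC -ltrBrDr.
  by move=> [k _ /=]; apply: lt_trans; rewrite ltrDl.
rewrite (_ : [set x | f x < inf A] = \bigcup_k [set x | f x <= inf A - k.+1%:R^-1]).
  apply: measure_bigcup_le => //.
    by move=> i j ij x /= /le_trans; apply; rewrite lerD2l lerN2 lef_pV2 ?posrE// ler_nat.
  move=> k; apply: notA => /(ge_inf hinf.2); rewrite leNgt => /negP; apply.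
  by rewrite ltrBlDr ltrDl.
apply/seteqP; split => x /=.
  rewrite -subr_gt0 => h.
  have [k _ /(_ k (leqnn _)) /= hk] := near_infty_natSinv_lt (PosNum h).
  by exists k => //=; rewrite lerBrDr addrC -lerBrDr ltW.
by move=> [k _ /=] /le_lt_trans; apply; rewrite ltrBlDr ltrDl.
Qed.

End Median.

(** * Passage from the median to the mean *)

Section MeanFromMedian.
Context d {T : measurableType d} {R : realType} (mu : probability T R).

(** The two tails give [E |f - m|^p <= 2 * B^p]. Integrating [t <= B + B * (t / B)^p] at
    [t = |f - m|] places the mean within [3 * B] of [m], and a triangle inequality for powers
    concludes. *)
Lemma Lnorm_centered_le (f : T -> R) (m p B : R) : 1 <= p -> 0 < B ->
  mu.-integrable setT (EFin \o f) ->
  (\int[mu]_x (Num.max (f x - m) 0 `^ p)%:E <= (B `^ p)%:E)%E ->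
  (\int[mu]_x (Num.max (- f x - - m) 0 `^ p)%:E <= (B `^ p)%:E)%E ->
  ('N[mu]_p%:E[EFin \o (fun x => f x - fine 'E_mu[f])%R] <= (12 * B)%:E)%E.
Proof.
move=> p1 B0 fi Hp Hn.
have p0 : 0 < p by lra.
have mf : measurable_fun setT f by have /integrableP[/measurable_EFinP] := fi.
have mpos : measurable_fun setT (fun x => Num.max (f x - m) 0 `^ p).
  apply: (@measurableT_comp _ _ _ _ _ _ (fun y => y `^ p)); first exact: measurable_powR.
  by apply: measurable_maxr => //; apply: measurable_funB.
have mneg : measurable_fun setT (fun x => Num.max (- f x - - m) 0 `^ p).
  apply: (@measurableT_comp _ _ _ _ _ _ (fun y => y `^ p)); first exact: measurable_powR.
  by apply: measurable_maxr => //; apply: measurable_funB => //; exact: measurable_funN.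
have absE x : `|f x - m| `^ p = Num.max (f x - m) 0 `^ p + Num.max (- f x - - m) 0 `^ p.
  have -> : - f x - - m = - (f x - m) by ring.
  have z0 : (0 : R) `^ p = 0 by rewrite powR0// gt_eqF.
  have [h|h] := leP 0 (f x - m).
    by rewrite ger0_norm// (max_idPr (_ : - (f x - m) <= 0)) ?oppr_le0// z0 addr0.
  by rewrite ltr0_norm// z0 add0r max_l// oppr_ge0 ltW.
have mabs : measurable_fun setT (fun x => `|f x - m| `^ p).
  by under eq_fun do rewrite absE; exact: measurable_funD.
have Habs : (\int[mu]_x (`|f x - m| `^ p)%:E <= (2 * B `^ p)%:E)%E.
  have -> : 2 * B `^ p = B `^ p + B `^ p by ring.
  rewrite EFinD; apply: le_trans (leeD Hp Hn).
  rewrite le_eqVlt; apply/orP; left; apply/eqP.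
  rewrite -ge0_integralD//; first last.
  - exact/measurable_EFinP.
  - by move=> x _; rewrite lee_fin powR_ge0.
  - exact/measurable_EFinP.
  - by move=> x _; rewrite lee_fin powR_ge0.
  by apply: eq_integral => x _; rewrite absE EFinD.
have Bp : 0 < B `^ p by exact: powR_gt0.
have iabs : mu.-integrable setT (EFin \o (fun x => `|f x - m| `^ p)).
  apply/integrableP; split; first exact/measurable_EFinP.
  under eq_integral do rewrite /= ger0_norm ?powR_ge0//.
  exact: le_lt_trans Habs (ltry _).
have icst c : mu.-integrable setT (EFin \o (fun=> c : R)) by exact: finite_measure_integrable_cst.
have ifm : mu.-integrable setT (EFin \o (fun x => f x - m)).
  exact: (integrableB measurableT fi (icst m)).
have iabs1 : mu.-integrable setT (EFin \o (fun x => `|f x - m|)) by exact: (integrable_abse ifm).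
set E := fine _.
have EE : E = \int[mu]_x f x by rewrite /E unlock.
have Habs' : \int[mu]_x (`|f x - m| `^ p) <= 2 * B `^ p.
  by rewrite -lee_fin -(EFin_Rintegral iabs).
have Em : `|E - m| <= 3 * B.
  have -> : E - m = \int[mu]_x (f x - m).
    by rewrite RintegralB// Rintegral_probability_cst EE.
  apply: le_trans (le_normr_Rintegral measurableT ifm) _.
  have i2 := integrableD measurableT (icst B)
     (integrableZl measurableT (B / B `^ p) iabs).
  apply: (@le_trans _ _ (\int[mu]_x (B + B / B `^ p * `|f x - m| `^ p))).
    apply: le_Rintegral => // x _.
    have [h|h] := leP `|f x - m| B.
      by apply: le_trans h _; rewrite lerDl mulr_ge0 ?powR_ge0// divr_ge0 ?(ltW B0) ?(ltW Bp).
    rewrite (@le_trans _ _ (B / B `^ p * `|f x - m| `^ p))// ?lerDr ?(ltW B0)//.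
    have -> : B / B `^ p * `|f x - m| `^ p = B * ((`|f x - m| / B) `^ p).
      rewrite powRM ?invr_ge0 ?(ltW B0)//.
      rewrite -(powR_inv1 (ltW B0)) -powRrM mulN1r powRN; ring.
    rewrite -ler_pdivrMl// mulrC; apply: le1r_powR => //.
    by rewrite ler_pdivlMr// mul1r ltW.
  rewrite RintegralD//; last exact: (integrableZl measurableT (B / B `^ p) iabs).
  rewrite Rintegral_probability_cst RintegralZl//.
  have -> : 3 * B = B + B / B `^ p * (2 * B `^ p) by field; rewrite gt_eqF.
  by rewrite lerD2l ler_pM2l// divr_gt0.
have Hfin : (\int[mu]_x (`|f x - E| `^ p)%:E <= ((12 * B) `^ p)%:E)%E.
  have i3 := integrableD measurableT (icst (2 `^ p * (3 * B) `^ p))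
     (integrableZl measurableT (2 `^ p) iabs).
  apply: (@le_trans _ _ (\int[mu]_x (2 `^ p * (3 * B) `^ p + 2 `^ p * `|f x - m| `^ p)%:E)%E).
    apply: ge0_le_integral => //.
    - apply/measurable_EFinP.
      apply: (@measurableT_comp _ _ _ _ _ _ (fun y => y `^ p)); first exact: measurable_powR.
      apply: (@measurableT_comp _ _ _ _ _ _ (@Num.norm R R)) => //.
      exact: measurable_funB.
    - by have /integrableP[] := i3.
    - move=> x _; rewrite lee_fin.
      have tri : `|f x - E| <= `|f x - m| + 3 * B.
        have -> : f x - E = (f x - m) - (E - m) by ring.
        by apply: le_trans (ler_normB _ _) _; rewrite lerD2l.
      have [h|h] := leP `|f x - m| (3 * B).
        apply: (@le_trans _ _ ((2 * (3 * B)) `^ p)).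
          apply: ge0_ler_powR; rewrite ?nnegrE ?(ltW p0) ?mulr_ge0 ?(ltW B0)//; lra.
        by rewrite powRM ?mulr_ge0 ?(ltW B0)// lerDl mulr_ge0 ?powR_ge0.
      apply: (@le_trans _ _ ((2 * `|f x - m|) `^ p)).
        apply: ge0_ler_powR; rewrite ?nnegrE ?(ltW p0) ?mulr_ge0//; lra.
      by rewrite [leLHS]powRM// lerDr mulr_ge0 ?powR_ge0.
  rewrite (EFin_Rintegral i3) lee_fin RintegralD//; last first.
    exact: (integrableZl measurableT (2 `^ p) iabs).
  rewrite Rintegral_probability_cst RintegralZl//.
  (* One factor 2 comes from the triangle inequality; the other absorbs the sum of two terms, each
     at most [(3 * B)^p]. *)
  have -> : (12 * B) `^ p = 2 `^ p * (2 `^ p * (3 * B) `^ p).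
    by rewrite -!powRM ?mulr_ge0 ?(ltW B0)//; congr (_ `^ _); ring.
  rewrite -mulrDr ler_pM2l ?powR_gt0//.
  have p2 : 2 <= 2 `^ p :> R by apply: le1r_powR => //; lra.
  have p3 : 2 <= 3 `^ p :> R.
    by apply: le_trans p2 _; apply: ge0_ler_powR; rewrite ?nnegrE ?(ltW p0)//; lra.
  rewrite powRM ?(ltW B0)//.
  have h3 : 0 < 3 `^ p * B `^ p :> R by rewrite mulr_gt0// powR_gt0.
  have h2 : 2 * B `^ p <= 3 `^ p * B `^ p by rewrite ler_pM2r.
  have h4 : 2 * (3 `^ p * B `^ p) <= 2 `^ p * (3 `^ p * B `^ p) by rewrite ler_pM2r.
  lra.
rewrite unlock.
rewrite (_ : \int[mu]_x _ = \int[mu]_x (`|f x - E| `^ p)%:E)%E; last first.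
  by apply: eq_integral => x _ /=.
have pi0 : 0 <= p^-1 by rewrite invr_ge0 ltW.
apply: le_trans (gt0_ler_poweR pi0 _ _ Hfin) _.
- by rewrite in_itv /= leey andbT integral_ge0// => x _; rewrite lee_fin powR_ge0.
- by rewrite in_itv /= leey andbT lee_fin powR_ge0.
by rewrite poweR_EFin -powRrM divff ?gt_eqF// powRr1// mulr_ge0// ltW.
Qed.

End MeanFromMedian.

(** * Invariance of the gradient norm under [f -> - f] *)

Section Negation.
Context {R : realType} (n : nat).

(** The chain rule above is used because it also covers points where a partial derivative does not
    exist. *)
Lemma gradN (f : 'rV[R]_n -> R) (x : 'rV[R]_n) : loc_lipschitz f ->
  grad (fun y => - f y) x = - grad f x.
Proof.
move=> lf; apply/rowP => i; rewrite !mxE.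
have dN : is_derive (f x) 1 (fun y : R => - y) (- 1).
  exact: is_deriveN.
by rewrite (derive_comp_loc_lipschitz _ lf dN) mulN1r.
Qed.

Lemma Psi_normN (Psi : 'rV[R]_n -> R) (p : R) (x : 'rV[R]_n) : condC Psi ->
  Psi_norm Psi p (- x) = Psi_norm Psi p x.
Proof.
move=> CPsi; rewrite /Psi_norm; congr inf; apply/seteqP.
by split=> a /= [a0 ax]; split=> //; move: ax;
  rewrite /Psi_scaled !scalerN -(condC6 CPsi).
Qed.

End Negation.

(** * The upper tail above a median *)

Section OneSided.
Context {R : realType} (n : nat) (alpha beta K D p : R) (Psi : 'rV[R]_n -> R)
  (mu : probability (borelRn R n) R).

(** The bootstrap runs with [kappa = K * D] and [d = 20 * sqrt e]. Its bound depends on [e] only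
    through [d], so the truncation can be removed. *)
Lemma mLSI_one_sided_moment (f : 'rV[R]_n -> R) (A m : R) :
  1 < alpha -> alpha <= 2 -> 2 <= beta -> 1 <= K -> 0 < D ->
  condC Psi -> condG Psi K alpha beta -> mLSI mu Psi D ->
  loc_lipschitz f -> beta <= p -> 0 < A ->
  (\int[mu]_x (Psi_norm Psi p (grad f x) `^ p)%:E <= (A `^ p)%:E)%E ->
  (mu [set x : borelRn R n | (m < f x)%R] <= (2^-1)%:E)%E ->
  (\int[mu]_x (Num.max (f x - m) 0 `^ p)%:E <=
   ((4 * ((27 + 36 * expR 1) * A * moment_const K D alpha beta)) `^ p)%:E)%E.
Proof.
move=> al1 al2 be2 K1 D0 CPsi GPsi mlsi lf bp A0 hA med.
have K0 : 0 < K by lra.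
have KD0 : 0 < K * D by rewrite mulr_gt0.
have p0 : 0 < p by lra.
have E0 : 0 < 27 + 36 * expR 1 :> R by have := expR_gt0 (1 : R); lra.
have i0 : 0 < (alpha - 1)^-1 by rewrite invr_gt0; lra.
apply: one_sided_moment => // [|e e0 e1].
  by rewrite !mulr_gt0 ?addr_gt0 ?mulr_gt0 ?addr_gt0 ?powR_gt0//; lra.
have alb : alpha <= beta by lra.
have := @bootstrap R alpha beta (K * D) p A (20 * e `^ 2^-1)
  (trunc_moment mu f e m) al1 al2 be2 bp KD0 A0.
rewrite (max_idPl _) ?mulr_ge0 ?powR_ge0//; apply.
- by move=> q q0; exact: trunc_moment_gt0.
- move=> q bq qp; have := trunc_moment_ratio m al1 alb K1 D0 CPsi GPsi mlsi lf
    A0 e0 e1 hA bq qp.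
  by rewrite -[3 * D * K]mulrA [D * K]mulrC.
- by move=> q bq qp; apply: median_trunc_moment => //; lra.
Qed.

End OneSided.

(** * Assembly of the two tails *)

Theorem theorem3p4 (R : realType) :
  exists C : R, 0 < C /\
  forall (n : nat) (alpha beta K D : R) (Psi : 'rV[R]_n -> R)
    (mu : probability (borelRn R n) R),
    1 < alpha -> alpha <= 2 -> 2 <= beta -> 1 <= K -> 0 < D ->
    condC Psi -> condG Psi K alpha beta ->
    mu `<< lebesgue_Rn n -> mLSI mu Psi D ->
    forall (f : 'rV[R]_n -> R) (p : R),
      mu.-integrable setT (EFin \o f) -> loc_lipschitz f -> beta <= p ->
      ('N[mu]_p%:E[EFin \o (fun x => f x - fine 'E_mu[f])%R] <=
       (C * moment_const K D alpha beta)%R%:E *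
       'N[mu]_p%:E[EFin \o (fun x => Psi_norm Psi p (grad f x))])%E.
Proof.
(* 12 comes from centring at the mean, 4 from removing the truncation, the rest from the
   bootstrap. *)
pose c : R := 12 * 4 * (27 + 36 * expR 1).
have c0 : 0 < c by have := expR_gt0 (1 : R); rewrite /c; lra.
exists c; split => // n alpha beta K D Psi mu al1 al2 be2 K1 D0 CPsi GPsi _ mlsi
  f p fi lf bp.
have K0 : 0 < K by lra.
have p0 : 0 < p by lra.
have KD0 : 0 < K * D by rewrite mulr_gt0.
have i0 : 0 < (alpha - 1)^-1 by rewrite invr_gt0; lra.
set L := moment_const K D alpha beta.
have L0 : 0 < L.
  by rewrite /L addr_gt0 ?mulr_gt0 ?addr_gt0 ?powR_gt0//; lra.
have cL0 : 0 < c * L by rewrite mulr_gt0.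
pose a x := Psi_norm Psi p (grad f x).
have a0 x : 0 <= a x by exact: Psi_norm_ge0.
have aE x : Psi_norm Psi p (grad (fun y => - f y) x) = a x.
  by rewrite gradN// Psi_normN.
pose I := (\int[mu]_x (a x `^ p)%:E)%E.
have I0 : (0 <= I)%E by apply: integral_ge0 => x _; rewrite lee_fin powR_ge0.
have -> : ('N[mu]_p%:E[EFin \o (fun x => Psi_norm Psi p (grad f x))] = I `^ p^-1)%E.
  rewrite unlock; congr poweR; apply: eq_integral => x _ /=.
  by rewrite ger0_norm// a0.
have [Iy|Ify] := eqVneq I +oo%E.
  by rewrite Iy poweRyr ?gt_eqF ?invr_gt0// gt0_muley ?leey// lte_fin.
have Ifin : I \is a fin_num by rewrite ge0_fin_numE// ltey.
rewrite -(fineK Ifin) poweR_EFin -EFinM.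
apply/lee_addgt0Pr => eps eps0; rewrite -EFinD.
(* [A] must be positive even when the gradient norm vanishes; the excess costs exactly [eps] after
   multiplication by [c * L]. *)
pose A := fine I `^ p^-1 + eps / (c * L).
have A0 : 0 < A by rewrite ltr_wpDl ?powR_ge0// divr_gt0.
have hA : (I <= (A `^ p)%:E)%E.
  rewrite -(fineK Ifin) lee_fin.
  have -> : fine I = (fine I `^ p^-1) `^ p.
    by rewrite -powRrM mulVf ?gt_eqF// powRr1// fine_ge0.
  apply: ge0_ler_powR; rewrite ?nnegrE ?powR_ge0 ?(ltW p0) ?(ltW A0)//.
  by rewrite lerDl divr_ge0// ltW.
have [m [medp medn]] := exists_median mu (measurable_superlevel lf).
pose B := 4 * ((27 + 36 * expR 1) * A * L).
have -> : c * L * fine I `^ p^-1 + eps = 12 * B.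
  have -> : 12 * B = c * L * A by rewrite /B /c; ring.
  by rewrite /A (mulrDr (c * L)) [c * L * (eps / _)]mulrC divfK ?gt_eqF//.
have E0 : 0 < 27 + 36 * expR 1 :> R by have := expR_gt0 (1 : R); lra.
apply: (@Lnorm_centered_le _ _ _ _ _ m) => //; first lra.
- by rewrite /B !mulr_gt0.
- exact: (mLSI_one_sided_moment al1 al2 be2 K1 D0 CPsi GPsi mlsi lf bp A0 hA medp).
(* The lower tail is the upper tail of [- f] above [- m]. *)
- apply: (mLSI_one_sided_moment al1 al2 be2 K1 D0 CPsi GPsi mlsi
    (loc_lipschitzN lf) bp A0).
  + by under eq_integral do rewrite aE.
  + rewrite (_ : [set x | - m < - f x] = [set x | f x < m])//.
    by apply/seteqP; split => x /=; rewrite ltrN2.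
Qed.
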